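(* Let $I\times\mathcal{U}\subseteq\mathbb{R}\times\mathbb{R}^n$ be open and connected, let $V(t,x)$ be a real-valued $C^2$ function on $I\times\mathcal{U}$, and let $x(t)=(x^1(t),\dots,x^n(t))$ be a maximal, nonconstant solution of $\ddot{x}=-\nabla_{x}V(t,x)$ satisfying the following properties: (i) there is a time $t_0$ at which $\dot{x}^i(t_0)=0$ for some $i\in\{1,\dots,n\}$; (ii) for this $i$ and $t_0$, $V_{ij}\big|_{(t_0,x(t_0))}\neq0$ for some $j\in\{1,\dots,n\}$, where $V_{ij}=\frac{\partial^2V}{\partial x^i\partial x^j}$; (iii) $\Delta_xV\big|_{(t,x(t))}\geq0$ for all $t$ in the domain of $x(t)$. If $x(t)$ is defined for all time $t\in\mathbb{R}$, then there is a one-parameter family of distinct solutions of $\ddot{x}=-\nabla_{x}V$ starting at some point $x(t_1)$ and accumulating at some later point $x(t_2)$ (with $t_1<t_2$).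
   Context: $\nabla_xV=(\partial_{x^1}V,\dots,\partial_{x^n}V)$ and $\Delta_xV=\sum_{i=1}^n\partial^2V/\partial (x^i)^2$ are the gradient and Laplacian in the variable $x\in\mathbb{R}^n$ only. Meaning of ''accumulating''. Let $x(t)$ be a solution of $\ddot x=-\nabla_xV$ defined on an interval containing $[a,a']$. A one-parameter family of distinct solutions starting at $x(a)$ and accumulating at $x(a')$ is a family $x_s$, $s\in(-\varepsilon,\varepsilon)$ for some $\varepsilon>0$, of solutions of $\ddot x=-\nabla_xV$ on $[a,a']$, depending $C^1$ on $s$, pairwise distinct, with $x_0=x$ and $x_s(a)=x(a)$ for all $s$, whose variation field $J(t)=\frac{\partial x_s(t)}{\partial s}\big|_{s=0}$ is not identically zero on $[a,a']$ and satisfies $J(a)=J(a')=0$. (It is not required that $x_s(a')=x(a')$.) *)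

(* Defs.v *)
From HB Require Import structures.
From mathcomp Require Import all_boot all_order all_algebra.
From mathcomp Require Import all_classical all_reals all_analysis.

Set Implicit Arguments.
Unset Strict Implicit.
Unset Printing Implicit Defensive.

Import Order.TTheory GRing.Theory Num.Theory.
Import numFieldNormedType.Exports.

Local Open Scope classical_set_scope.
Local Open Scope ring_scope.

(* The derivative of f at t relative to J: the limit of the difference quotient
   over the points of J other than t. It is the usual derivative at an interior
   point of J and the one-sided derivative at an endpoint of the interval J. *)
Definition diff_quot_within (R : realType) (W : normedModType R) (J : set R)
    (f : R -> W) (t : R) : set_system W :=
  h^-1 *: (f (h + t) - f t) @[h --> within [set h : R | J (h + t)] 0^'].

Definition derivable_within (R : realType) (W : normedModType R) (J : set R)
    (f : R -> W) (t : R) : Prop :=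
  cvg (diff_quot_within J f t).

Definition derive_within (R : realType) (W : normedModType R) (J : set R)
    (f : R -> W) (t : R) : W :=
  lim (diff_quot_within J f t).

(* Only used for A open, so that the values of f outside A are irrelevant. *)
Definition C1_on (R : realType) (W : normedModType R) (A : set W)
    (f : W -> R) : Prop :=
  (forall p, A p -> differentiable f p) /\
  (forall (v p : W), A p -> {for p, continuous ('D_v f)}).

Definition C2_on (R : realType) (W : normedModType R) (A : set W)
    (f : W -> R) : Prop :=
  C1_on A f /\ (forall v : W, C1_on A ('D_v f)).

Section Potential.
Variables (R : realType) (n : nat).

(* The derivative in the i-th coordinate of x, as a function of (t, x). *)
Definition partial_x (i : 'I_n) (V : R * 'rV[R]_n -> R) : R * 'rV[R]_n -> R :=
  'D_(0, delta_mx 0 i) V.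

Definition grad_x (V : R * 'rV[R]_n -> R) (p : R * 'rV[R]_n) : 'rV[R]_n :=
  \row_i partial_x i V p.

Definition hess_x (V : R * 'rV[R]_n -> R) (p : R * 'rV[R]_n) (i j : 'I_n) : R :=
  partial_x i (partial_x j V) p.

Definition laplacian_x (V : R * 'rV[R]_n -> R) (p : R * 'rV[R]_n) : R :=
  \sum_i hess_x V p i i.

Variables (I : set R) (U : set 'rV[R]_n) (V : R * 'rV[R]_n -> R).

(* x restricted to the nondegenerate (open, closed, ...) interval J solves
   x'' = - grad_x V (t, x), where V is only given on I x U. *)
Definition solution_on (J : set R) (x : R -> 'rV[R]_n) : Prop :=
  [/\ is_interval J,
      (exists a b, [/\ J a, J b & a < b]),
      (forall t, J t -> (I `*` U) (t, x t))
    & forall t, J t ->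
        [/\ derivable_within J x t,
            derivable_within J (derive_within J x) t
          & derive_within J (derive_within J x) t = - grad_x V (t, x t)]].

Definition maximal_solution (D : set R) (x : R -> 'rV[R]_n) : Prop :=
  solution_on D x /\
  (forall (D' : set R) (y : R -> 'rV[R]_n),
     solution_on D' y -> D `<=` D' -> (forall t, D t -> y t = x t) -> D' = D).

Definition variation_field (X : R -> R -> 'rV[R]_n) (t : R) : 'rV[R]_n :=
  derive1 (X^~ t) 0.

(* X s t stands for x_s(t); the dependence on s is C^1 in the sense that the
   s-derivative exists and is jointly continuous in (s, t). *)
Definition accumulating_family (x : R -> 'rV[R]_n) (a a' e : R)
    (X : R -> R -> 'rV[R]_n) : Prop :=
  [/\ 0 < e,
      (forall s, s \in `]- e, e[ -> solution_on `[a, a'] (X s)),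
      (forall s t, s \in `]- e, e[ -> t \in `[a, a'] ->
         derivable (X^~ t) s 1) /\
      {within `]- e, e[ `*` `[a, a'],
         continuous (fun p : R * R => derive1 (X^~ p.2) p.1)},
      (forall s s', s \in `]- e, e[ -> s' \in `]- e, e[ -> s != s' ->
         exists2 t, t \in `[a, a'] & X s t != X s' t)
    & [/\ (forall t, t \in `[a, a'] -> X 0 t = x t),
          (forall s, s \in `]- e, e[ -> X s a = x a),
          (exists2 t, t \in `[a, a'] & variation_field X t != 0),
          variation_field X a = 0
        & variation_field X a' = 0]].

End Potential.

(* Main.v *)
Require Import Defs.
From HB Require Import structures.
From mathcomp Require Import all_boot all_order all_algebra.
From mathcomp Require Import all_classical all_reals all_analysis.
From mathcomp Require Import ring lra.

Import Order.TTheory GRing.Theory Num.Theory.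
Import numFieldNormedType.Exports.

Local Open Scope classical_set_scope.
Local Open Scope ring_scope.

(** A field J along x is a Jacobi field if J'' = - J H, where H(t) is the
    Hessian of V in the space variables at (t, x(t)).  Two things have to be
    shown: some nonzero Jacobi field vanishes at two times t1 < t2, and every
    Jacobi field vanishing at t1 is the variation field of an actual family of
    solutions through x(t1).

    Conjugate points.  Let A be the matrix of Jacobi fields with A(a) = 0 and
    A'(a) = 1.  If A is invertible on (a, b], then U = A^-1 A' is defined there
    and solves the Riccati equation U' = - U^2 - H; the Wronskian identity and
    the symmetry of H make U symmetric.  Completing the square gives, for every
    curve M of symmetric matrices,
      (tr M U M)' = tr M'^2 - tr M H M - |M' - U M|^2 <= tr M'^2 - tr M H M
    ([riccati_test_le]), which is the second variation inequality.  Linear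
    cutoffs M = phi 1 and tr H >= 0 force tr U to be small far away from a and
    from b ([riccati_trace_bounds]).  Near t0, M = 1 + eps psi K with
    K = H(t0) <> 0 and psi a bump makes the integral of the right-hand side
    negative by a fixed amount: its part of order zero in eps is - tr H <= 0,
    and its part of order one is - 2 psi tr (H K), where tr (H K) > 0 near t0.
    With a and b far from t0 the two conflict; as x is defined for all times,
    a and b may be chosen so.  Hence A is singular at some t2 in (a, b]
    ([conjugate_points_exist]), and v A with v A(t2) = 0 is the wanted Jacobi
    field.

    The family.  Solutions are sought as x + Y_s with Y_s(a) = 0 and
    Y_s'(a) = s v.  Truncating the force outside a tube around x makes it
    globally Lipschitz, so the Y_s exist by Picard iteration
    ([second_order_ivp]) and stay in the tube for small s.  One Gronwall
    estimate ([second_order_gronwall]), applied in turn to differences of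
    solutions, to the remainder of the first-order expansion in s and to
    differences of the linearized solutions, shows that s |-> Y_s is C^1
    ([perturbation_family]). *)

(** * Matrix norms and derivatives of matrix-valued curves *)

Lemma mx_norm_leP {R : realType} {m n : nat} (M : 'M[R]_(m, n)) (d : R) :
  0 <= d -> reflect (forall i j, `|M i j| <= d) (`|M| <= d).
Proof.
move=> d0; have -> : `|M| = \big[Num.max/0]_ij `|M ij.1 ij.2| by exact: mx_normrE.
apply: (iffP idP) => [/bigmax_leP[_ h] i j|h]; first exact: (h (i, j)).
by apply/bigmax_leP; split.
Qed.

Lemma mx_entry_le {R : realType} {m n : nat} (M : 'M[R]_(m, n)) i j :
  `|M i j| <= `|M|.
Proof. exact: (mx_norm_leP M _ (normr_ge0 _) (lexx _)). Qed.

Lemma mx_cvgP {R : realType} {T : Type} {F : set_system T} {FF : Filter F} {m n : nat}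
    (f : T -> 'M[R]_(m, n)) (M : 'M[R]_(m, n)) :
  f @ F --> M <-> forall i j, f x i j @[x --> F] --> M i j.
Proof.
split=> [h i j|h].
  apply: (@cvg_comp _ _ _ f (fun N : 'M[R]_(m, n) => N i j) F (nbhs M)) => //.
  exact: coord_continuous.
apply/cvgrPdist_le => e e0; near=> x.
apply/mx_norm_leP; first exact: ltW.
move=> i j; rewrite !mxE; move: i j; near: x.
apply: filter_forall => i; apply: filter_forall => j.
by have /cvgrPdist_le := h i j; apply.
Unshelve. all: by end_near. Qed.

Lemma cvg_mulmx {R : realType} {T : Type} {F : set_system T} {FF : Filter F}
    {m n p : nat} (f : T -> 'M[R]_(m, n)) (g : T -> 'M[R]_(n, p))
    (M : 'M[R]_(m, n)) (N : 'M[R]_(n, p)) :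
  f @ F --> M -> g @ F --> N -> (f x *m g x) @[x --> F] --> M *m N.
Proof.
move=> /mx_cvgP hf /mx_cvgP hg; apply/mx_cvgP => i j.
rewrite mxE; under eq_fun do rewrite mxE.
apply: (@cvg_big R 'I_n +%R 0 xpredT _ T F _ (fun k x => f x i k * g x k j)).
  exact: add_continuous.
by move=> k _; apply: cvgM.
Qed.

Lemma is_derive_mxP {R : realType} {m n : nat} (M : R -> 'M[R]_(m, n))
    (dM : 'M[R]_(m, n)) (t : R) :
  is_derive t 1 M dM <-> forall i j, is_derive t 1 (fun s => M s i j) (dM i j).
Proof.
split=> [[Mt <-] i j|h].
  by split; [exact: (derivable_mxP M t 1).1|rewrite derive_mx// mxE].
have Mt : derivable M t 1 by apply/derivable_mxP => i j; have [] := h i j.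
split=> //; rewrite derive_mx//; apply/matrixP => i j; rewrite mxE.
by have [] := h i j.
Qed.

Lemma is_derive_continuous {R : realType} {V : normedModType R} {f : R -> V} {t : R} {l} :
  is_derive t 1 f l -> {for t, continuous f}.
Proof. by case=> /derivable1_diffP /differentiable_continuous. Qed.

Lemma is_derive_Mr {R : realType} (f : R -> R) (t l c : R) : is_derive t 1 f l ->
  is_derive t 1 (fun s => f s * c) (l * c).
Proof.
move=> h; apply: (is_derive_eq (is_deriveM h (is_derive_cst c t (1:R)))).
by rewrite scaler0 add0r /= -[RHS]mulrC.
Qed.

Lemma is_derive_pow {R : realType} (f : R -> R) (t l : R) k : is_derive t 1 f l ->
  is_derive t 1 (fun s => f s ^+ k) (k%:R * f t ^+ k.-1 * l).
Proof.
move=> h; rewrite (_ : (fun s => _) = f ^+ k); first exact: is_deriveX.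
by apply/funext => s; rewrite exprfctE.
Qed.

Lemma le_of_derive_le {R : realType} (f g df dg : R -> R) (p q : R) : p <= q ->
  (forall t, t \in `[p, q] -> is_derive t 1 f (df t)) ->
  (forall t, t \in `[p, q] -> is_derive t 1 g (dg t)) ->
  (forall t, t \in `[p, q] -> df t <= dg t) ->
  f q - f p <= g q - g p.
Proof.
move=> pq hf hg hle.
pose h t := g t - f t.
have hd t : t \in `[p, q] -> is_derive t 1 h (dg t - df t).
  by move=> tpq; apply: is_deriveB; [exact: hg|exact: hf].
have ch : {within `[p, q], continuous h}.
  by apply: derivable_within_continuous => t /hd [].
have hd' t : t \in `]p, q[ -> is_derive t 1 h (dg t - df t).
  by move=> /subset_itv_oo_cc; exact: hd.
have [c cpq e] := MVT_segment pq hd' ch.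
rewrite -subr_ge0 (_ : _ - _ = h q - h p); last by rewrite /h; ring.
by rewrite e mulr_ge0 ?subr_ge0// hle.
Qed.

(** The sup norm is not differentiable, so the scalar comparison is applied to
    each entry and to its opposite. *)
Lemma norm_le_of_derive_le {R : realType} {m n : nat} (f df : R -> 'M[R]_(m, n))
    (g dg : R -> R) (p q : R) : p <= q ->
  (forall t, t \in `[p, q] -> is_derive t 1 f (df t)) ->
  (forall t, t \in `[p, q] -> is_derive t 1 g (dg t)) ->
  (forall t, t \in `[p, q] -> `|df t| <= dg t) ->
  `|f q - f p| <= g q - g p.
Proof.
move=> pq hf hg hle.
have g0 : 0 <= g q - g p.
  rewrite -[leLHS](subrr (0:R)).
  apply: (@le_of_derive_le R (cst 0) g (cst 0) dg) => // t tpq.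
  by apply: le_trans (hle t tpq).
have hfij i j t : t \in `[p, q] -> is_derive t 1 (fun s => f s i j) (df t i j).
  by move=> tpq; have /is_derive_mxP := hf t tpq.
have hfle i j t : t \in `[p, q] -> `|df t i j| <= dg t.
  by move=> tpq; apply: le_trans (mx_entry_le _ i j) (hle t tpq).
apply/mx_norm_leP => // i j; rewrite !mxE ler_norml; apply/andP; split.
  have hN t : t \in `[p, q] -> is_derive t 1 (fun s => - f s i j) (- df t i j).
    by move=> tpq; apply: is_deriveN; exact: hfij.
  have := le_of_derive_le _ _ _ _ _ _ pq hN hg.
  rewrite opprK lerNl opprB addrC; apply=> t tpq.
  by apply: le_trans (hfle i j t tpq); rewrite -normrN ler_norm.
apply: (le_of_derive_le _ _ _ _ _ _ pq (hfij i j) hg) => t tpq.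
by apply: le_trans (hfle i j t tpq); rewrite ler_norm.
Qed.

Lemma is_derive_exp {R : realType} (lam a t : R) :
  is_derive t 1 (fun s => expR (lam * (s - a))) (lam * expR (lam * (t - a))).
Proof.
have h : is_derive t 1 (fun s : R => (s - a) * lam) (1 * lam).
  apply: is_derive_Mr; apply: is_derive_eq (is_deriveB (is_derive_id t (1:R)) (is_derive_cst a t (1:R))) _.
  by rewrite subr0.
rewrite (_ : (fun s => _) = expR \o (fun s => (s - a) * lam)); last first.
  by apply/funext => s /=; rewrite mulrC.
apply: (is_derive_eq (@is_derive1_comp R expR (fun s => (s - a) * lam) t _ _ _ h)).
by rewrite mul1r mulrC [(_ - _) * _]mulrC.
Qed.

(** * Primitives of continuous functions *)

Lemma primitive_exists {R : realType} (f : R -> R) (a b : R) : continuous f ->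
  exists F, F a = 0 /\ forall t, t \in `[a, b] -> is_derive t 1 F (f t).
Proof.
move=> cf; pose mu := @lebesgue_measure R.
(* Starting the integral to the left of a makes a an interior point, so that
   the derivative at a is two-sided. *)
pose G y := (\int[mu]_(t in `[a - 1, y]) f t)%R.
exists (fun y => G y - G a); split=> [|t]; first by rewrite subrr.
rewrite in_itv /= => /andP[at_ tb].
have hi : mu.-integrable `[a - 1, b + 1] (EFin \o f).
  apply: continuous_compact_integrable; first exact: segment_compact.
  exact: continuous_subspaceT.
have tb1 : t < b + 1 by lra.
have [||dG eG] := @continuous_FTC1_closed R f (a - 1) t (b + 1) tb1 hi; first lra.
  exact: cf.
have hG : is_derive t 1 G (f t) by split; [exact: dG|rewrite -derive1E; exact: eG].
apply: (is_derive_eq (is_deriveB hG (is_derive_cst (G a) t (1:R)))).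
by rewrite subr0.
Qed.

Lemma primitive_mx_exists {R : realType} {m n : nat} (f : R -> 'M[R]_(m, n))
    (a b : R) : continuous f ->
  exists F, F a = 0 /\ forall t, t \in `[a, b] -> is_derive t 1 F (f t).
Proof.
move=> cf.
have h (ij : 'I_m * 'I_n) : exists F, F a = 0 /\
    forall t, t \in `[a, b] -> is_derive t 1 F (f t ij.1 ij.2).
  apply: primitive_exists => t.
  apply: (@continuous_comp _ _ _ f (fun M => M ij.1 ij.2)); first exact: cf.
  exact: coord_continuous.
have [F hF] := choice h.
exists (fun t => \matrix_(i, j) F (i, j) t); split.
  by apply/matrixP => i j; rewrite !mxE; have [] := hF (i, j).
move=> t tab; apply/is_derive_mxP => i j.
under eq_fun do rewrite mxE.
by have [_] := hF (i, j); apply.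
Qed.

(** * Growth estimates for second-order equations *)

(** Two integrations: each divides the exponential bound by lam.  Both the Picard
    contraction and the Gronwall estimate come from the factor lam ^ -2. *)
Lemma second_order_bound {R : realType} {m n : nat} (y p q : R -> 'M[R]_(m, n))
    (a b lam eta K : R) : 0 < lam -> 0 <= K ->
  (forall t, t \in `[a, b] -> is_derive t 1 y (p t)) ->
  (forall t, t \in `[a, b] -> is_derive t 1 p (q t)) ->
  y a = 0 -> `|p a| <= eta ->
  (forall t, t \in `[a, b] -> `|q t| <= K * expR (lam * (t - a))) ->
  forall t, t \in `[a, b] ->
    `|y t| <= (eta / lam + K / lam ^+ 2) * expR (lam * (t - a)).
Proof.
move=> lam0 K0 hy hp ya pa hq t.
have prim (c s : R) : is_derive s 1 (fun s => expR (lam * (s - a)) * (c / lam))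
    (c * expR (lam * (s - a))).
  apply: (is_derive_eq (is_derive_Mr _ _ _ (c / lam) (is_derive_exp lam a s))).
  by field; rewrite gt_eqF.
have eta0 : 0 <= eta by apply: le_trans pa.
have e1 s : a <= s -> 1 <= expR (lam * (s - a)).
  by move=> as_; rewrite -[leLHS]expR0 ler_expR mulr_ge0 ?subr_ge0// ltW.
have sub s r : s \in `[a, b] -> r \in `[a, s] -> r \in `[a, b].
  rewrite !in_itv/= => /andP[_ sb] /andP[-> rs] /=; exact: le_trans sb.
have ea : expR (lam * (a - a)) = 1 by rewrite subrr mulr0 expR0.
have bp s : s \in `[a, b] ->
    `|p s| <= (eta + K / lam) * expR (lam * (s - a)).
  move=> sab; have /andP[as_ sb] : a <= s <= b by rewrite in_itv/= in sab.
  have := norm_le_of_derive_le p q _ _ a s as_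
    (fun r h => hp r (sub s r sab h)) (fun r _ => prim K r)
    (fun r h => hq r (sub s r sab h)).
  rewrite ea mul1r => h.
  have -> : p s = p a + (p s - p a) by rewrite addrC subrK.
  apply: le_trans (ler_normD _ _) _.
  apply: le_trans (lerD pa h) _.
  have := ler_wpM2l eta0 (e1 s as_); rewrite mulr1.
  have : 0 <= K / lam by rewrite divr_ge0// ltW.
  rewrite mulrDl (mulrC (expR _)); lra.
move=> tab; have /andP[at_ tb] : a <= t <= b by rewrite in_itv/= in tab.
have := norm_le_of_derive_le y p _ _ a t at_
    (fun r h => hy r (sub t r tab h)) (fun r _ => prim (eta + K / lam) r)
    (fun r h => bp r (sub t r tab h)).
rewrite ya subr0 ea mul1r => /le_trans; apply.
have -> : (eta + K / lam) / lam = eta / lam + K / lam ^+ 2.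
  by field; rewrite gt_eqF.
rewrite [leRHS]mulrC gerBl addr_ge0// divr_ge0// ?ltW// exprn_gt0//.
Qed.

Definition gronwall_cst {R : realType} (L d : R) : R :=
  2 * expR ((1 + 2 * L) * d).

Lemma gronwall_cst_gt0 {R : realType} (L d : R) : 0 < gronwall_cst L d.
Proof. by rewrite mulr_gt0// expR_gt0. Qed.

(** With w = sup |y| exp (- lam (t - a)) the previous bound reads
    w <= eta / lam + (L w + eps) / lam^2, and lam = 1 + 2 L satisfies
    lam^2 >= 2 L, so half of w can be absorbed.  A second-order version is used,
    rather than one for the pair (y, y'), so that only y itself is compared. *)
Lemma second_order_gronwall {R : realType} {m n : nat} (y p q : R -> 'M[R]_(m, n))
    (a b L eta eps : R) : 0 <= L -> 0 <= eps ->
  (forall t, t \in `[a, b] -> is_derive t 1 y (p t)) ->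
  (forall t, t \in `[a, b] -> is_derive t 1 p (q t)) ->
  y a = 0 -> `|p a| <= eta ->
  (forall t, t \in `[a, b] -> `|q t| <= L * `|y t| + eps) ->
  forall t, t \in `[a, b] -> `|y t| <= gronwall_cst L (b - a) * (eta + eps).
Proof.
move=> L0 eps0 hy hp ya pa hq t tab.
have /andP[at_ tb] : a <= t <= b by rewrite in_itv/= in tab.
pose lam := 1 + 2 * L.
have lam1 : 1 <= lam by rewrite lerDl mulr_ge0.
have lam0 : 0 < lam by apply: lt_le_trans lam1.
pose w s := `|y s| / expR (lam * (s - a)).
have cw : {within `[a, b], continuous w}.
  have dw : {in `[a, b], forall s, {for s, continuous w}}.
    move=> s sab; apply: continuousM.
      apply: (@continuous_comp _ _ _ y Num.norm).
        by apply: is_derive_continuous (hy s sab).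
      exact: norm_continuous.
    apply: continuousV; first by rewrite gt_eqF// expR_gt0.
    exact: is_derive_continuous (is_derive_exp lam a s).
  by apply: continuous_in_subspaceT => s; rewrite inE; apply: dw.
have [c cab hc] := EVT_max (le_trans at_ tb) cw.
have yw s : s \in `[a, b] -> `|y s| <= w c * expR (lam * (s - a)).
  by move=> sab; rewrite -ler_pdivrMr ?expR_gt0//; apply: hc.
have wc0 : 0 <= w c by rewrite divr_ge0// expR_ge0.
have e1 s : s \in `[a, b] -> 1 <= expR (lam * (s - a)).
  rewrite in_itv/= => /andP[as_ _].
  by rewrite -[leLHS]expR0 ler_expR mulr_ge0 ?subr_ge0// ltW.
have hK s : s \in `[a, b] -> `|q s| <= (L * w c + eps) * expR (lam * (s - a)).
  move=> sab; apply: (le_trans (hq s sab)); rewrite mulrDl lerD//.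
    by rewrite -mulrA ler_wpM2l// yw.
  by rewrite ler_peMr// e1.
have K0 : 0 <= L * w c + eps by rewrite addr_ge0// mulr_ge0.
have := second_order_bound y p q a b lam eta _ lam0 K0 hy hp ya pa hK.
move=> /(_ c cab); rewrite -ler_pdivrMr ?expR_gt0// -/(w c) => wle.
have eta0 : 0 <= eta by apply: le_trans pa.
have : w c <= eta + eps + w c / 2.
  apply: (le_trans wle); rewrite -addrA lerD//.
    by rewrite ler_pdivrMr// ler_peMr.
  rewrite ler_pdivrMr ?exprn_gt0//.
  have l2 : 2 * L <= lam ^+ 2 by rewrite /lam; nra.
  have l1 : 1 <= lam ^+ 2 by rewrite /lam; nra.
  have := ler_wpM2l wc0 l2; have := ler_wpM2l eps0 l1.
  lra.
move=> wle2; have {}wle2 : w c <= 2 * (eta + eps) by lra.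
apply: (le_trans (yw t tab)).
rewrite /gronwall_cst -/lam [leRHS]mulrAC ler_pM// ?expR_ge0//.
rewrite ler_expR; apply: ler_wpM2l; [exact: ltW|lra].
Qed.

(** * Truncation and uniform limits *)

(** The nearest point of [a, b]: composing with it extends to the whole line a
    function that is only controlled on [a, b]. *)
Definition clamp {R : realType} (a b t : R) := Num.max a (Num.min b t).

Lemma clamp_itv {R : realType} (a b t : R) : a <= b -> clamp a b t \in `[a, b].
Proof.
move=> ab; rewrite in_itv /= /clamp le_max lexx /=.
by rewrite ge_max ab ge_min lexx.
Qed.

Lemma clamp_id {R : realType} (a b t : R) : t \in `[a, b] -> clamp a b t = t.
Proof. by rewrite in_itv /= => /andP[at_ tb]; rewrite /clamp min_r// max_r. Qed.

Lemma clamp_dist {R : realType} (a b s t : R) :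
  `|clamp a b s - clamp a b t| <= `|s - t|.
Proof.
wlog st : s t / s <= t.
  by case: (leP s t) => [?|/ltW ?] h; last rewrite distrC (distrC s); exact: h.
rewrite (distrC s) (ger0_norm (_ : 0 <= t - s)) ?subr_ge0// ler_norml /clamp.
by case: (leP b s); case: (leP b t); case: (leP a b); case: (leP a s);
  case: (leP a t) => *; apply/andP; split; lra.
Qed.

Lemma clamp_continuous {R : realType} (a b : R) : continuous (clamp a b).
Proof.
move=> t; apply/cvgrPdist_le => e e0; near=> s.
apply: le_trans (clamp_dist _ _ _ _) _; near: s.
by exists e => //= s /ltW.
Unshelve. all: by end_near. Qed.

Lemma continuous_comp_clamp {R : realType} {T : topologicalType} (a b : R)
    (f : R -> T) : a <= b ->
  (forall t, t \in `[a, b] -> {for t, continuous f}) ->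
  continuous (fun t => f (clamp a b t)).
Proof.
move=> ab cf t; apply: (@continuous_comp _ _ _ (clamp a b) f).
  exact: clamp_continuous.
by apply: cf; exact: clamp_itv.
Qed.

Lemma geometric_uniform_limit {R : realType} {p q : nat}
    (u : nat -> R -> 'M[R]_(p, q)) (C : R) :
  (forall k, continuous (u k)) ->
  (forall k t, `|u k.+1 t - u k t| <= C / 2 ^+ k) ->
  exists w : R -> 'M[R]_(p, q), continuous w /\ forall k t, `|w t - u k t| <= 2 * C / 2 ^+ k.
Proof.
move=> cu hu.
have C0 : 0 <= C.
  by have := hu 0%N 0; rewrite expr0 divr1; apply: le_trans.
have p2 k : 0 < 2 ^+ k :> R by rewrite exprn_gt0.
have hkm k m t : `|u (k + m)%N t - u k t| <= 2 * C / 2 ^+ k - 2 * C / 2 ^+ (k + m).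
  elim: m => [|m IH]; first by rewrite addn0 !subrr normr0.
  apply: (le_trans (ler_distD (u (k + m)%N t) _ _)); rewrite addnS.
  apply: (le_trans (lerD (hu _ _) IH)).
  have -> : C / 2 ^+ (k + m) = 2 * C / 2 ^+ (k + m) - 2 * C / 2 ^+ (k + m).+1.
    by rewrite exprS; field; rewrite gt_eqF.
  lra.
have hkm' k m t : `|u (k + m)%N t - u k t| <= 2 * C / 2 ^+ k.
  by apply: (le_trans (hkm k m t)); rewrite gerBl divr_ge0// ?mulr_ge0// ltW.
have small (e : R) : 0 < e -> exists k, 2 * C / 2 ^+ k < e.
  move=> e0.
  have : geometric (2 * C) (2^-1 : R) n @[n --> \oo] --> 0.
    by apply: cvg_geometric; rewrite ger0_norm// invf_lt1// ltr1n.
  move=> /cvgrPdist_lt /(_ e e0) [N _ /(_ N (leqnn N))] /=.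
  rewrite sub0r normrN ger0_norm ?mulr_ge0// exprVn => ?.
  by exists N.
have cvu t : cvgn (u ^~ t).
  apply/cauchy_cvgP; apply: cauchy_exP => e e0.
  have [k hk] := small e e0.
  exists (u k t); exists k => // m /= km.
  rewrite -ball_normE /= distrC; apply: le_lt_trans hk.
  by have := hkm' k (m - k)%N t; rewrite subnKC.
pose w t := limn (u ^~ t).
have hw k t : `|w t - u k t| <= 2 * C / 2 ^+ k.
  apply/ler_addgt0Pr => e e0.
  have /cvgrPdist_lt /(_ e e0) [N _ hN] := cvu t.
  have := hN (k + N)%N (leq_addl _ _); rewrite -/(w t) => h1.
  apply: (le_trans (ler_distD (u (k + N)%N t) _ _)).
  rewrite addrC; apply: lerD; [exact: hkm'|exact: ltW].
exists w; split=> // t.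
apply/cvgrPdist_lt => e e0.
have [|k hk] := small (e / 3); first by rewrite divr_gt0.
near=> s.
have h : `|u k t - u k s| < e / 3.
  by near: s; have /cvgrPdist_lt := cu k t; apply; rewrite divr_gt0.
have := hw k t; have := hw k s; rewrite (distrC (w s)) => h1 h2.
apply: (le_lt_trans (ler_distD (u k t) _ _)).
have := ler_distD (u k s) (u k t) (w s) => h3.
lra.
Unshelve. all: by end_near. Qed.

(** * Existence for second-order initial value problems *)

Lemma continuous_bounded_itv {R : realType} {V : normedModType R} (f : R -> V)
    (a b : R) : (forall t, t \in `[a, b] -> {for t, continuous f}) ->
  exists2 M, 0 <= M & forall t, t \in `[a, b] -> `|f t| <= M.
Proof.
move=> cf; have [ab|ba] := leP a b; last first.
  exists 0 => // t; rewrite in_itv/= => /andP[at_ tb].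
  by have := le_trans at_ tb; rewrite leNgt ba.
have [|c cab hc] := @EVT_max R (fun t => `|f t|) a b ab.
  apply: continuous_in_subspaceT => t; rewrite inE => tab.
  apply: (@continuous_comp _ _ _ f Num.norm); first exact: cf.
  exact: norm_continuous.
by exists `|f c|.
Qed.

(** Picard iteration for the integrated equation y = P (v + P (F (., y))), where
    P f is the primitive of f vanishing at a.  In the norm weighted by
    exp (- lam (t - a)) the iteration contracts by 1/2 on the whole of [a, b],
    so no subdivision of the interval is needed. *)
Lemma second_order_ivp {R : realType} {m n : nat} (F : R -> 'M[R]_(m, n) -> 'M[R]_(m, n))
    (a b L : R) (v : 'M[R]_(m, n)) : a <= b -> 0 <= L ->
  (forall t, t \in `[a, b] -> forall y z, `|F t y - F t z| <= L * `|y - z|) ->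
  (forall y, continuous y -> continuous (fun t => F (clamp a b t) (y t))) ->
  exists y p, [/\ y a = 0, p a = v,
    (forall t, t \in `[a, b] -> is_derive t 1 y (p t)) &
    (forall t, t \in `[a, b] -> is_derive t 1 p (F t (y t)))].
Proof.
move=> ab L0 hL hF.
have exQ (f : R -> 'M[R]_(m, n)) : exists G : R -> 'M[R]_(m, n), continuous f ->
    G a = 0 /\ forall t, t \in `[a, b] -> is_derive t 1 G (f t).
  have [cf|ncf] := pselect (continuous f); last by exists (cst 0) => /ncf.
  by have [G hG] := primitive_mx_exists f a b cf; exists G.
have [Q hQ] := choice exQ.
have aab : a \in `[a, b] by rewrite in_itv/= lexx ab.
(* Q f is a primitive only on [a, b]; truncating the time argument keeps the
   iterates continuous on the whole line. *)
pose P f t := Q f (clamp a b t).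
have cP f : continuous f -> continuous (P f).
  move=> cf; apply: continuous_comp_clamp => // t tab.
  exact: is_derive_continuous ((hQ f cf).2 t tab).
have PQ f t : t \in `[a, b] -> P f t = Q f t by move=> tab; rewrite /P clamp_id.
pose G (y : R -> 'M[R]_(m, n)) t := F (clamp a b t) (y t).
pose p y t := v + P (G y) t.
have cp y : continuous y -> continuous (p y).
  by move=> cy t; apply: cvgD; [exact: cvg_cst|apply: cP; exact: hF].
pose T y := P (p y).
have cT y : continuous y -> continuous (T y).
  by move=> cy; apply: cP; exact: cp.
have dT y t : continuous y -> t \in `[a, b] -> is_derive t 1 (Q (p y)) (p y t).
  by move=> cy; exact: (hQ _ (cp y cy)).2.
have dp y t : continuous y -> t \in `[a, b] ->
    is_derive t 1 (fun s => v + Q (G y) s) (F t (y t)).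
  move=> cy tab; have := (hQ _ (hF y cy)).2 t tab; rewrite clamp_id// => h.
  apply: (is_derive_eq (is_deriveD (is_derive_cst v t (1:R)) h)).
  by rewrite add0r.
have pE y t : t \in `[a, b] -> p y t = v + Q (G y) t.
  by move=> tab; rewrite /p PQ.
pose lam := 1 + 2 * L.
have lam1 : 1 <= lam by rewrite lerDl mulr_ge0.
have lam0 : 0 < lam by apply: lt_le_trans lam1.
have e1 s : s \in `[a, b] -> 1 <= expR (lam * (s - a)).
  rewrite in_itv/= => /andP[as_ _].
  by rewrite -[leLHS]expR0 ler_expR mulr_ge0 ?subr_ge0// ltW.
have contr y z K : continuous y -> continuous z -> 0 <= K ->
    (forall t, t \in `[a, b] -> `|y t - z t| <= K * expR (lam * (t - a))) ->
    forall t, t \in `[a, b] -> `|T y t - T z t| <= K / 2 * expR (lam * (t - a)).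
  move=> cy cz K0 hK t tab.
  have := @second_order_bound R m n (fun t => Q (p y) t - Q (p z) t)
    (fun t => (v + Q (G y) t) - (v + Q (G z) t)) (fun t => F t (y t) - F t (z t))
    a b lam 0 (L * K) lam0 (mulr_ge0 L0 K0).
  rewrite mul0r add0r => h; rewrite /T !PQ//; apply: le_trans (h _ _ _ _ _ t tab) _.
  - move=> s sab; apply: is_deriveB; rewrite -pE//; exact: dT.
  - by move=> s sab; apply: is_deriveB; exact: dp.
  - by rewrite (hQ _ (cp y cy)).1 (hQ _ (cp z cz)).1 subrr.
  - by rewrite (hQ _ (hF y cy)).1 (hQ _ (hF z cz)).1 subrr normr0.
  - move=> s sab; apply: le_trans (hL s sab _ _) _.
    by rewrite -mulrA ler_wpM2l// hK.
  - rewrite ler_wpM2r ?expR_ge0// ler_pdivrMr ?exprn_gt0//.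
    have l2 : 2 * L <= lam ^+ 2 by rewrite /lam; nra.
    have := ler_wpM2l K0 l2; lra.
pose u k := iter k T (cst 0).
have cu k : continuous (u k).
  by elim: k => [|k IH]; [exact: cst_continuous|exact: cT].
have uclamp k t : u k t = u k (clamp a b t).
  by case: k => [//|k]; rewrite /= /T /P (clamp_id _ _ (clamp _ _ _)) ?clamp_itv.
have [M M0 hM] : exists2 M, 0 <= M & forall t, t \in `[a, b] -> `|F t 0| <= M.
  have [|M M0 hM] := continuous_bounded_itv (G (cst 0)) a b.
    by move=> t _; apply: hF; exact: cst_continuous.
  by exists M => // t tab; have := hM t tab; rewrite /G clamp_id.
pose C := `|v| + M.
have C0 : 0 <= C by rewrite addr_ge0.
have hu1 t : t \in `[a, b] -> `|u 1%N t - u 0%N t| <= C * expR (lam * (t - a)).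
  move=> tab.
  have c0 : continuous (cst 0 : R -> 'M[R]_(m, n)) by exact: cst_continuous.
  have := @second_order_bound R m n (Q (p (cst 0))) (fun t => v + Q (G (cst 0)) t)
    (fun t => F t 0) a b lam `|v| M lam0 M0.
  rewrite /= subr0 /T PQ// => h; apply: le_trans (h _ _ _ _ _ t tab) _.
  - by move=> s sab; rewrite -pE//; exact: dT.
  - by move=> s sab; exact: (dp (cst 0)).
  - by rewrite (hQ _ (cp _ c0)).1.
  - by rewrite (hQ _ (hF _ c0)).1 addr0.
  - by move=> s sab; apply: le_trans (hM s sab) _; rewrite ler_peMr// e1.
  - rewrite ler_wpM2r ?expR_ge0// lerD// ler_pdivrMr ?exprn_gt0// ler_peMr//.
    by rewrite -[leLHS](expr1n _ 2) lerXn2r ?nnegrE// ltW.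
have p2 k : 0 < 2 ^+ k :> R by rewrite exprn_gt0.
have huk k t : t \in `[a, b] ->
    `|u k.+1 t - u k t| <= C / 2 ^+ k * expR (lam * (t - a)).
  elim: k t => [|k IH] t tab; first by rewrite expr0 divr1; exact: hu1.
  have -> : C / 2 ^+ k.+1 = C / 2 ^+ k / 2.
    by rewrite exprS; field; rewrite gt_eqF.
  by apply: (contr (u k.+1) (u k)) => //; rewrite divr_ge0// ltW.
pose E := expR (lam * (b - a)).
have eE t : t \in `[a, b] -> expR (lam * (t - a)) <= E.
  rewrite in_itv/= => /andP[_ tb].
  by rewrite ler_expR; apply: ler_wpM2l; [exact: ltW|lra].
have [||w [cw hw]] := geometric_uniform_limit u (C * E); first exact: cu.
  move=> k t; rewrite (uclamp k.+1) (uclamp k).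
  have tab := clamp_itv a b t ab; apply: le_trans (huk k _ tab) _.
  by rewrite mulrAC ler_wpM2r ?invr_ge0 ?(ltW (p2 k))// ler_wpM2l// eE.
(* w is within 2 C E / 2^k of the k-th iterate, and T w within half the weighted
   distance of the next one. *)
have fixw t : t \in `[a, b] -> w t = T w t.
  move=> tab; apply/eqP; rewrite -subr_eq0 -normr_eq0 eq_le normr_ge0 andbT.
  apply/ler_addgt0Pr => e e0; rewrite add0r.
  pose D := 2 * (C * E) * (1 + E).
  have E0 : 0 <= E by exact: expR_ge0.
  have D0 : 0 <= D by rewrite !mulr_ge0// addr_ge0.
  have hk k : `|w t - T w t| <= D / 2 ^+ k.
    have K0 : 0 <= 2 * (C * E) / 2 ^+ k by rewrite divr_ge0 ?mulr_ge0// ltW.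
    have := contr (u k) w _ (cu k) cw K0 _ t tab.
    have hwk s : s \in `[a, b] ->
        `|u k s - w s| <= 2 * (C * E) / 2 ^+ k * expR (lam * (s - a)).
      by move=> sab; rewrite distrC; apply: le_trans (hw k s) _; rewrite ler_peMr// e1.
    move=> /(_ hwk) h1; have h2 := hw k.+1 t.
    apply: (le_trans (ler_distD (u k.+1 t) _ _)); apply: le_trans (lerD h2 h1) _.
    have -> : D / 2 ^+ k = 2 * (C * E) / 2 ^+ k + 2 * (C * E) / 2 ^+ k * E.
      by rewrite /D; field; rewrite gt_eqF.
    apply: lerD.
      rewrite exprS ler_wpM2l ?mulr_ge0// lef_pV2 ?posrE ?mulr_gt0//.
      by rewrite ler_peMl ?ler1n// ltW.
    apply: ler_pM; rewrite ?expR_ge0 ?eE//; last by lra.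
    by rewrite divr_ge0.
  have : geometric D (2^-1 : R) k @[k --> \oo] --> 0.
    by apply: cvg_geometric; rewrite ger0_norm// invf_lt1// ltr1n.
  move=> /cvgrPdist_lt /(_ e e0) [N _ /(_ N (leqnn N))] /=.
  rewrite sub0r normrN exprVn -/(D / _) ger0_norm ?divr_ge0 ?(ltW (p2 N))// => /ltW.
  exact: le_trans.
(* The fixed point w agrees with Q (p w) on [a, b], but only the latter is
   differentiable from both sides at the endpoints. *)
exists (Q (p w)), (fun t => v + Q (G w) t); split.
- by rewrite (hQ _ (cp w cw)).1.
- by rewrite (hQ _ (hF w cw)).1 addr0.
- by move=> t tab; rewrite -pE//; exact: dT.
- move=> t tab; have -> : Q (p w) t = w t by rewrite fixw// /T PQ.
  exact: dp.
Qed.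

(** * Differentiable dependence on the initial velocity *)

Lemma is_derive_of_small_remainder {R : realType} {V : normedModType R}
    (f : R -> V) (s : R) (l : V) :
  (forall eps, 0 < eps -> exists2 d, 0 < d &
    forall h, `|h| < d -> `|f (h + s) - f s - h *: l| <= eps * `|h|) ->
  is_derive s 1 f l.
Proof.
move=> hf.
have cv : h^-1 *: (f (h *: 1 + s) - f s) @[h --> 0^'] --> l.
  apply/cvgrPdist_le => e e0; have [d d0 hd] := hf e e0.
  near=> h.
  have h0 : h != 0 by near: h; exact: nbhs_dnbhs_neq.
  have hd' : `|h| < d by near: h; exact: dnbhs0_lt.
  have -> : h *: (1:R) = h by rewrite /GRing.scale /= mulr1.
  have -> : l = h^-1 *: (h *: l) by rewrite scalerA mulVf// scale1r.
  rewrite -scalerBr normrZ normfV mulrC ler_pdivrMr ?normr_gt0//.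
  by rewrite distrC; exact: hd.
split; first by apply/cvg_ex; exists l.
exact: cvg_lim.
Unshelve. all: by end_near. Qed.

Section parameter_dependence.
Context {R : realType} {n : nat}.
Variables (a b r L : R) (g : R -> 'rV[R]_n -> 'rV[R]_n)
  (H : R -> 'rV[R]_n -> 'M[R]_n) (v : 'rV[R]_n).
Hypotheses (ab : a <= b) (r0 : 0 < r) (L0 : 0 <= L).
Hypothesis g0 : forall t, t \in `[a, b] -> g t 0 = 0.
Hypothesis g_lip : forall t, t \in `[a, b] ->
  forall y z, `|g t y - g t z| <= L * `|y - z|.
Hypothesis H_le : forall t, t \in `[a, b] -> forall y (w : 'rV[R]_n), `|w *m H t y| <= L * `|w|.
Hypothesis g_mvt : forall t, t \in `[a, b] -> forall y z, `|y| <= r -> `|z| <= r ->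
  forall i, exists2 th, 0 <= th <= 1 &
    (g t z - g t y) 0 i = ((z - y) *m H t (y + th *: (z - y))) 0 i.
Hypothesis g_cont : forall y, continuous y ->
  continuous (fun t => g (clamp a b t) (y t)).
Hypothesis H_cont : forall y, continuous y ->
  continuous (fun t => H (clamp a b t) (y t)).
Hypothesis H_unif : forall y, (forall t, t \in `[a, b] -> {for t, continuous y}) ->
  forall eps, 0 < eps -> exists2 d, 0 < d & forall t, t \in `[a, b] ->
  forall z, `|z - y t| <= d -> forall w : 'rV[R]_n, `|w *m (H t z - H t (y t))| <= eps * `|w|.

Let C := gronwall_cst L (b - a).
Let C0 : 0 < C. Proof. exact: gronwall_cst_gt0. Qed.

(** Y s solves the equation with initial velocity s v, and Z s the equation
    linearized along Y s.  All three estimates come from the Gronwall lemma: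
    Y s' - Y s is O(s' - s); the remainder Y s' - Y s - (s' - s) Z s solves the
    linearized equation up to an error (Y s' - Y s) (H xi - H (Y s)), which is
    o(s' - s) because H is uniformly continuous along Y s; and Z s' - Z s solves
    it up to the error Z s (H (Y s') - H (Y s)).  Continuity of H suffices, so
    the potential need not be better than C^2. *)
Lemma perturbation_family :
  exists e (Y Yp Z Zp : R -> R -> 'rV[R]_n), [/\ 0 < e,
    (forall t, t \in `[a, b] -> Y 0 t = 0),
    (forall s, `|s| < e -> [/\ Y s a = 0, Yp s a = s *: v &
      forall t, t \in `[a, b] -> [/\ is_derive t 1 (Y s) (Yp s t),
        is_derive t 1 (Yp s) (g t (Y s t)) & `|Y s t| < r]]),
    (forall s, `|s| < e -> [/\ Z s a = 0, Zp s a = v &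
      forall t, t \in `[a, b] -> [/\ is_derive t 1 (Z s) (Zp s t),
        is_derive t 1 (Zp s) (Z s t *m H t (Y s t)) &
        is_derive s 1 (Y ^~ t) (Z s t)]]) &
    forall s t, `|s| < e -> t \in `[a, b] -> forall eps, 0 < eps ->
      exists2 d, 0 < d & forall s' t', `|s'| < e -> t' \in `[a, b] ->
        `|s' - s| < d -> `|t' - t| < d -> `|Z s' t' - Z s t| <= eps].
Proof.
have exY s : exists y p, [/\ y a = 0, p a = s *: v,
    (forall t, t \in `[a, b] -> is_derive t 1 y (p t)) &
    (forall t, t \in `[a, b] -> is_derive t 1 p (g t (y t)))].
  exact: second_order_ivp ab L0 g_lip g_cont.
have [Y {}exY] := choice exY; have [Yp hY] := choice exY.
have cY s t : t \in `[a, b] -> {for t, continuous (Y s)}.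
  by case: (hY s) => _ _ h _ /h; exact: is_derive_continuous.
have exZ s : exists y p, [/\ y a = 0, p a = v,
    (forall t, t \in `[a, b] -> is_derive t 1 y (p t)) &
    (forall t, t \in `[a, b] -> is_derive t 1 p (y t *m H t (Y s t)))].
  apply: (second_order_ivp (fun t z => z *m H t (Y s t)) a b L v ab L0).
    by move=> t tab y z; rewrite -mulmxBl; exact: H_le.
  move=> y cy.
  have cYc := continuous_comp_clamp a b (Y s) ab (cY s).
  have cH := H_cont _ cYc.
  by move=> t; apply: cvg_mulmx; [exact: cy|exact: cH].
have [Z {}exZ] := choice exZ; have [Zp hZ] := choice exZ.
have Ylip s s' t : t \in `[a, b] -> `|Y s' t - Y s t| <= C * `|v| * `|s' - s|.
  move=> tab; have [y0 p0 dy dp] := hY s; have [y0' p0' dy' dp'] := hY s'.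
  have := @second_order_gronwall R 1 n (fun t => Y s' t - Y s t)
    (fun t => Yp s' t - Yp s t) (fun t => g t (Y s' t) - g t (Y s t))
    a b L (`|v| * `|s' - s|) 0 L0 (lexx _) _ _ _ _ _ t tab.
  rewrite addr0 -/C mulrA; apply.
  - by move=> u uab; apply: is_deriveB; [exact: dy'|exact: dy].
  - by move=> u uab; apply: is_deriveB; [exact: dp'|exact: dp].
  - by rewrite y0 y0' subrr.
  - by rewrite p0 p0' -scalerBl normrZ mulrC.
  - by move=> u uab; rewrite addr0; exact: g_lip.
have Z_le s t : t \in `[a, b] -> `|Z s t| <= C * `|v|.
  move=> tab; have [z0 p0 dz dp] := hZ s.
  have := @second_order_gronwall R 1 n (Z s) (Zp s) (fun t => Z s t *m H t (Y s t))
    a b L `|v| 0 L0 (lexx _) dz dp z0 _ _ t tab.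
  rewrite addr0 p0; apply=> // u uab; rewrite addr0; exact: H_le.
pose K := C * `|v| + 1.
have K0 : 0 < K by rewrite ltr_wpDl// mulr_ge0// ltW.
pose e := r / K.
have e0 : 0 < e by rewrite divr_gt0.
have Y0 t : t \in `[a, b] -> Y 0 t = 0.
  move=> tab; have [y0 p0 dy dp] := hY 0.
  have := @second_order_gronwall R 1 n (Y 0) (Yp 0) (fun t => g t (Y 0 t))
    a b L 0 0 L0 (lexx _) dy dp y0 _ _ t tab.
  rewrite addr0 mulr0 p0 scale0r normr0 normr_le0 => h; apply/eqP; apply: h => //.
  move=> u uab; rewrite addr0.
  by have := g_lip u uab (Y 0 u) 0; rewrite g0// !subr0.
have Yr s t : `|s| < e -> t \in `[a, b] -> `|Y s t| < r.
  move=> se tab; have := Ylip 0 s t tab; rewrite Y0//.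
  rewrite !subr0 => h; apply: le_lt_trans h _.
  apply: (@le_lt_trans _ _ (K * `|s|)).
    by rewrite ler_wpM2r// lerDl.
  by rewrite mulrC -ltr_pdivlMr.
exists e, Y, Yp, Z, Zp; split=> //.
- move=> s se; have [y0 p0 dy dp] := hY s; split=> // t tab.
  by split; [exact: dy|exact: dp|exact: Yr].
- move=> s se; have [z0 q0 dz dq] := hZ s; split=> // t tab.
  split; [exact: dz|exact: dq|].
  have [y0 p0 dy dp] := hY s.
  apply: is_derive_of_small_remainder => eps eps0.
  pose eta := eps / (C * K).
  have eta0 : 0 < eta by rewrite divr_gt0// mulr_gt0.
  have [d d0 hd] := H_unif (Y s) (cY s) eta eta0.
  exists (Num.min (d / K) (e - `|s|)).
    by rewrite lt_min divr_gt0//= subr_gt0.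
  move=> h; rewrite lt_min => /andP[hK he].
  pose s' := h + s.
  have s'e : `|s'| < e by rewrite (le_lt_trans (ler_normD _ _))// -ltrBrDr.
  have s's : s' - s = h by rewrite /s' addrK.
  have [y0' p0' dy' dp'] := hY s'.
  have Yd u : u \in `[a, b] -> `|Y s' u - Y s u| <= K * `|h|.
    move=> uab; apply: le_trans (Ylip s s' u uab) _.
    by rewrite s's ler_wpM2r// lerDl.
  have := @second_order_gronwall R 1 n (fun t => Y s' t - Y s t - h *: Z s t)
    (fun t => Yp s' t - Yp s t - h *: Zp s t)
    (fun t => g t (Y s' t) - g t (Y s t) - h *: (Z s t *m H t (Y s t)))
    a b L 0 (eta * K * `|h|) L0 _ _ _ _ _ _ t tab.
  rewrite add0r => hg; apply: le_trans (hg _ _ _ _ _ _) _.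
  + by apply: mulr_ge0 => //; apply: mulr_ge0; apply: ltW.
  + move=> u uab; apply: is_deriveB; last by apply: is_deriveZ; exact: dz.
    by apply: is_deriveB; [exact: dy'|exact: dy].
  + move=> u uab; apply: is_deriveB; last by apply: is_deriveZ; exact: dq.
    by apply: is_deriveB; [exact: dp'|exact: dp].
  + by rewrite y0 y0' z0 scaler0 !subr0.
  + by rewrite p0 p0' q0 -scalerBl s's subrr normr0.
  + move=> u uab; apply/mx_norm_leP.
      by apply: addr_ge0; apply: mulr_ge0 => //; apply: mulr_ge0; apply: ltW.
    move=> k i; rewrite ord1.
    have [th /andP[th0 th1] hth] := g_mvt u uab (Y s u) (Y s' u)
      (ltW (Yr s u se uab)) (ltW (Yr s' u s'e uab)) i.
    (* The intermediate point depends on the entry i, so the comparison of the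
       two matrices has to be made entry by entry. *)
    set xi := Y s u + _ in hth.
    have -> : (g u (Y s' u) - g u (Y s u) - h *: (Z s u *m H u (Y s u))) 0 i =
        ((Y s' u - Y s u - h *: Z s u) *m H u (Y s u) +
         (Y s' u - Y s u) *m (H u xi - H u (Y s u))) 0 i.
      rewrite mulmxBl mulmxBr -scalemxAl [in RHS]addrC [in RHS]addrA subrK.
      by rewrite mxE hth [RHS]mxE.
    apply: le_trans (mx_entry_le _ _ _) _; apply: le_trans (ler_normD _ _) _.
    apply: lerD; first exact: H_le.
    rewrite -mulrA; apply: le_trans (hd u uab xi _ _) _; last first.
      by rewrite ler_wpM2l ?Yd// ltW.
    rewrite /xi addrC addKr normrZ ger0_norm//.
    apply: (@le_trans _ _ (1 * (K * `|h|))); first by rewrite ler_pM// Yd.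
    by rewrite mul1r mulrC -ler_pdivlMr// ltW.
  + rewrite -/C mulrA ler_wpM2r// /eta.
    by rewrite le_eqVlt; apply/orP; left; apply/eqP; field; rewrite !gt_eqF.
- move=> s t se tab eps eps0.
  have [z0 q0 dz dq] := hZ s.
  pose eta := eps / (2 * C * K).
  have eta0 : 0 < eta by apply: divr_gt0 => //; do 2?apply: mulr_gt0.
  have [d d0 hd] := H_unif (Y s) (cY s) eta eta0.
  have /cvgrPdist_lt /(_ (eps / 2)) := is_derive_continuous (dz t tab).
  move=> /(_ (divr_gt0 eps0 (ltr0Sn _ 1))) [d1 /= d10 hd1].
  exists (Num.min (d / K) d1).
    by rewrite lt_min divr_gt0.
  move=> s' t' s'e t'ab; rewrite lt_min => /andP[hs' _]; rewrite lt_min => /andP[_ ht'].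
  have [z0' q0' dz' dq'] := hZ s'.
  have h1 : `|Z s' t' - Z s t'| <= eps / 2.
    have := @second_order_gronwall R 1 n (fun t => Z s' t - Z s t)
      (fun t => Zp s' t - Zp s t)
      (fun t => Z s' t *m H t (Y s' t) - Z s t *m H t (Y s t))
      a b L 0 (eta * K) L0 _ _ _ _ _ _ t' t'ab.
    rewrite add0r => hg; apply: le_trans (hg _ _ _ _ _ _) _.
    + by apply: mulr_ge0; apply: ltW.
    + by move=> u uab; apply: is_deriveB; [exact: dz'|exact: dz].
    + by move=> u uab; apply: is_deriveB; [exact: dq'|exact: dq].
    + by rewrite z0 z0' subrr.
    + by rewrite q0 q0' subrr normr0.
    + move=> u uab.
      have -> : Z s' u *m H u (Y s' u) - Z s u *m H u (Y s u) =
        (Z s' u - Z s u) *m H u (Y s' u) + Z s u *m (H u (Y s' u) - H u (Y s u)).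
        by rewrite mulmxBl mulmxBr addrA subrK.
      apply: le_trans (ler_normD _ _) _; apply: lerD; first exact: H_le.
      apply: le_trans (hd u uab _ _ _) _.
        apply: le_trans (Ylip s s' u uab) _.
        apply: (@le_trans _ _ (K * `|s' - s|)); first by rewrite ler_wpM2r// lerDl.
        by rewrite mulrC -ler_pdivlMr// ltW.
      rewrite ler_wpM2l// ?ltW//; apply: le_lt_trans (Z_le s u uab) _.
      by rewrite ltrDl.
    + rewrite -/C /eta.
      by rewrite le_eqVlt; apply/orP; left; apply/eqP; field; rewrite !gt_eqF.
  have h2 : `|Z s t - Z s t'| < eps / 2 by apply: hd1; rewrite /= distrC.
  apply: le_trans (ler_distD (Z s t') _ _) _.
  rewrite (distrC (Z s t')); lra.
Qed.

End parameter_dependence.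

(** * Derivatives of matrix functions *)

Section matrix_calculus.
Context {R : realType}.

Lemma derivable_bigsum (I : Type) (r : seq I) (h : I -> R -> R) (t : R) :
  (forall i, derivable (h i) t 1) ->
  derivable (fun s => \sum_(i <- r) h i s) t 1.
Proof.
move=> dh; elim: r => [|i r IH].
  by under eq_fun do rewrite big_nil; exact: derivable_cst.
by under eq_fun do rewrite big_cons; exact: derivableD.
Qed.

Lemma derivable_bigprod (I : Type) (r : seq I) (h : I -> R -> R) (t : R) :
  (forall i, derivable (h i) t 1) ->
  derivable (fun s => \prod_(i <- r) h i s) t 1.
Proof.
move=> dh; elim: r => [|i r IH].
  by under eq_fun do rewrite big_nil; exact: derivable_cst.
by under eq_fun do rewrite big_cons; exact: derivableM.
Qed.

Lemma is_derive_bigsum (I : Type) (r : seq I) (h : I -> R -> R) (dh : I -> R)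
    (t : R) : (forall i, is_derive t 1 (h i) (dh i)) ->
  is_derive t 1 (fun s => \sum_(i <- r) h i s) (\sum_(i <- r) dh i).
Proof.
move=> hd; elim: r => [|i r IH].
  by under eq_fun do rewrite big_nil; rewrite big_nil; exact: is_derive_cst.
by under eq_fun do rewrite big_cons; rewrite big_cons; exact: is_deriveD.
Qed.

Lemma derivable_det {n : nat} (A : R -> 'M[R]_n) (t : R) :
  (forall i j, derivable (fun s => A s i j) t 1) ->
  derivable (fun s => \det (A s)) t 1.
Proof.
move=> dA; apply: derivable_bigsum => s; apply: derivableM.
  exact: derivable_cst.
by apply: derivable_bigprod => i; exact: dA.
Qed.

Lemma is_derive_mulmx {m n p : nat} (A : R -> 'M[R]_(m, n)) (B : R -> 'M[R]_(n, p))
    (dA : 'M[R]_(m, n)) (dB : 'M[R]_(n, p)) (t : R) :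
  is_derive t 1 A dA -> is_derive t 1 B dB ->
  is_derive t 1 (fun s => A s *m B s) (dA *m B t + A t *m dB).
Proof.
move=> /is_derive_mxP hA /is_derive_mxP hB; apply/is_derive_mxP => i j.
under eq_fun do rewrite mxE; rewrite !mxE -big_split /=.
apply: is_derive_bigsum => k.
apply: (is_derive_eq (is_deriveM (hA i k) (hB k j))).
by rewrite /GRing.scale /=; ring.
Qed.

Lemma is_derive_trmx {m n : nat} (A : R -> 'M[R]_(m, n)) (dA : 'M[R]_(m, n)) (t : R) :
  is_derive t 1 A dA -> is_derive t 1 (fun s => (A s)^T) dA^T.
Proof.
move=> /is_derive_mxP hA; apply/is_derive_mxP => i j.
by under eq_fun do rewrite mxE; rewrite mxE.
Qed.

Lemma is_derive_mxtrace {n : nat} (A : R -> 'M[R]_n) (dA : 'M[R]_n) (t : R) :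
  is_derive t 1 A dA -> is_derive t 1 (fun s => \tr (A s)) (\tr dA).
Proof. by move=> /is_derive_mxP hA; apply: is_derive_bigsum. Qed.

Lemma is_derive_scalemx {m n : nat} (f : R -> R) (df : R) (K : 'M[R]_(m, n)) (t : R) :
  is_derive t 1 f df -> is_derive t 1 (fun s => f s *: K) (df *: K).
Proof.
move=> hf; apply/is_derive_mxP => i j.
by under eq_fun do rewrite mxE; rewrite mxE; exact: is_derive_Mr.
Qed.

(** Cramer's rule shows that the inverse is differentiable; its derivative then
    follows by differentiating A A^-1 = 1. *)
Lemma is_derive_invmx {n : nat} (A : R -> 'M[R]_n) (dA : 'M[R]_n) (t : R) :
  A t \in unitmx -> is_derive t 1 A dA ->
  is_derive t 1 (fun s => invmx (A s)) (- (invmx (A t) *m dA *m invmx (A t))).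
Proof.
move=> At hA.
have dAij i j : derivable (fun s => A s i j) t 1.
  by have /is_derive_mxP /(_ i j) [] := hA.
have ddet := derivable_det A t dAij.
have det0 : \det (A t) != 0 by rewrite unitmxE unitfE in At.
have near_unit : \forall s \near t, A s \in unitmx.
  have cdet : {for t, continuous (fun s => \det (A s))}.
    by apply: differentiable_continuous; exact/derivable1_diffP.
  have : \forall s \near t, \det (A s) != 0.
    exact: (cvgr_neq0 _ cdet det0).
  by apply: filterS => s; rewrite unitmxE unitfE.
pose B s := (\det (A s))^-1 *: \adj (A s).
have eB : \forall s \near t, B s = invmx (A s).
  by apply: filterS near_unit => s; rewrite /B /invmx => ->.
have dB : derivable B t 1.
  apply/derivable_mxP => i j; rewrite /B.
  under eq_fun do rewrite !mxE; apply: derivableM; first exact: derivableV.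
  apply: derivableM; first exact: derivable_cst.
  by apply: derivable_det => k l; under eq_fun do rewrite !mxE; exact: dAij.
have hB : is_derive t 1 (fun s => invmx (A s)) ('D_1 B t).
  exact: (near_eq_is_derive eB (DeriveDef dB erefl)).
apply: (is_derive_eq hB).
have h1 := is_derive_mulmx A (fun s => invmx (A s)) _ _ t hA hB.
have h2 : is_derive t 1 (fun s => A s *m invmx (A s)) 0.
  apply: (@near_eq_is_derive _ _ _ (cst 1%:M)).
  by apply: filterS near_unit => s As; rewrite mulmxV.
have : dA *m invmx (A t) + A t *m 'D_1 B t = 0.
  by rewrite -(@derive_val _ _ _ _ _ _ _ h1) (@derive_val _ _ _ _ _ _ _ h2).
move=> /eqP; rewrite addrC addr_eq0 => /eqP e.
by rewrite -[LHS](mulKmx At) e mulmxN mulmxA.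
Qed.

Lemma mxtrace_sqr_ge0 {n : nat} (X : 'M[R]_n) : 0 <= \tr (X^T *m X).
Proof.
apply: sumr_ge0 => i _; rewrite mxE; apply: sumr_ge0 => j _.
by rewrite mxE -expr2 sqr_ge0.
Qed.

Lemma mxtrace_sqr_gt0 {n : nat} (X : 'M[R]_n) : X != 0 -> 0 < \tr (X^T *m X).
Proof.
move=> X0; rewrite lt_def mxtrace_sqr_ge0 andbT; apply: contra X0 => /eqP.
have h (i : 'I_n) : 0 <= (X^T *m X) i i.
  by rewrite mxE; apply: sumr_ge0 => j _; rewrite mxE -expr2 sqr_ge0.
move=> /psumr_eq0P e; apply/eqP/matrixP => k i; rewrite mxE.
have := e (fun i _ => h i) i isT; rewrite mxE => /psumr_eq0P e2.
have := e2 (fun j _ => _) k isT; rewrite mxE => /(_ _) /eqP.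
rewrite mulf_eq0 orbb => h2; apply/eqP; apply: h2 => j.
by rewrite mxE -expr2 sqr_ge0.
Qed.

End matrix_calculus.

(** * Riccati comparison and conjugate points *)

Section riccati.
Context {R : realType} {n : nat}.

(** The second variation inequality: the derivative of tr (M U M) is
    tr (M' M') - tr (M H M) minus the trace of the square of M' - U M, which is
    a sum of squares because M, M' and U are symmetric. *)
Lemma riccati_test_le (U M : R -> 'M[R]_n) (H dM : R -> 'M[R]_n) (g dg : R -> R)
    (p q : R) : p <= q ->
  (forall t, t \in `[p, q] -> (U t)^T = U t) ->
  (forall t, t \in `[p, q] -> is_derive t 1 U (- (U t *m U t) - H t)) ->
  (forall t, t \in `[p, q] -> is_derive t 1 M (dM t)) ->
  (forall t, (M t)^T = M t) -> (forall t, (dM t)^T = dM t) ->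
  (forall t, t \in `[p, q] -> is_derive t 1 g (dg t)) ->
  (forall t, t \in `[p, q] ->
     \tr (dM t *m dM t) - \tr (M t *m H t *m M t) <= dg t) ->
  \tr (M q *m U q *m M q) - \tr (M p *m U p *m M p) <= g q - g p.
Proof.
move=> pq symU dU hM symM symdM hg hle.
apply: (le_of_derive_le (fun t => \tr (M t *m U t *m M t)) g _ dg p q pq _ hg).
  move=> t tpq; apply: is_derive_mxtrace.
  apply: is_derive_mulmx; last exact: hM.
  by apply: is_derive_mulmx; [exact: hM|exact: dU].
move=> t tpq; apply: le_trans (hle t tpq).
have := mxtrace_sqr_ge0 (dM t - U t *m M t).
have -> : (dM t - U t *m M t)^T = dM t - M t *m U t.
  by rewrite linearB /= trmx_mul symdM symM symU.
move=> h; rewrite -subr_ge0 -!linearB /=; apply: le_trans h _.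
rewrite le_eqVlt; apply/orP; left; apply/eqP; congr (\tr _).
rewrite !(mulmxDl, mulmxDr, mulmxN, mulNmx, opprD, opprK, mulmxA).
move: (dM t *m dM t) (dM t *m U t *m M t) (M t *m U t *m dM t)
  (M t *m U t *m U t *m M t) (M t *m H t *m M t) => X1 X2 X3 X4 X5.
by apply/matrixP => i j; rewrite !mxE; ring.
Qed.

(** The test curve is a linear function going from 0 to 1, respectively from 1 to
    0, on [s, u] times the identity; its energy is n / (u - s). *)
Lemma riccati_trace_bounds (U H : R -> 'M[R]_n) (s u : R) : s < u ->
  (forall t, t \in `[s, u] -> (U t)^T = U t) ->
  (forall t, t \in `[s, u] -> is_derive t 1 U (- (U t *m U t) - H t)) ->
  (forall t, 0 <= \tr (H t)) ->
  \tr (U u) <= n%:R / (u - s) /\ - (n%:R / (u - s)) <= \tr (U s).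
Proof.
move=> su symU dU trH.
have us0 : u - s != 0 by rewrite subr_eq0 gt_eqF.
have dlin (c k t : R) : is_derive t (1:R) (fun t => k * (t - c)) k.
  have := is_derive_Mr _ _ _ k (is_deriveB (is_derive_id t (1:R)) (is_derive_cst c t (1:R))).
  by under eq_fun do rewrite mulrC; rewrite subr0 mul1r.
have cutoff (c k : R) : k ^+ 2 = (u - s) ^- 2 ->
    (k * (u - c)) ^+ 2 * \tr (U u) - (k * (s - c)) ^+ 2 * \tr (U s) <= n%:R / (u - s).
  move=> k2.
  have := riccati_test_le U (fun t => (k * (t - c)) *: 1%:M) H (fun t => k *: 1%:M)
    (fun t => t * (n%:R * k ^+ 2)) (fun=> 1 * (n%:R * k ^+ 2)) s u (ltW su) symU dU.
  rewrite -!scalemxAl !mul1mx -!scalemxAr !mulmx1 !scalerA !mxtraceZ -!expr2.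
  have -> : u * (n%:R * k ^+ 2) - s * (n%:R * k ^+ 2) = n%:R / (u - s).
    by rewrite k2; field.
  apply.
  - by move=> t _; apply: is_derive_scalemx.
  - by move=> t; rewrite linearZ /= trmx1.
  - by move=> t; rewrite linearZ /= trmx1.
  - by move=> t _; apply: is_derive_Mr; exact: is_derive_id.
  - move=> t _; rewrite -!scalemxAl !mul1mx -!scalemxAr !mulmx1 !scalerA !mxtraceZ.
    rewrite -!expr2 mxtrace1 mul1r mulrC lerBlDr lerDl.
    by rewrite mulr_ge0 ?sqr_ge0.
split.
  have := cutoff s (u - s)^-1.
  rewrite subrr mulr0 expr0n /= mul0r subr0 mulVf// expr1n mul1r; apply.
  by rewrite exprVn.
have := cutoff u (u - s)^-1.
rewrite subrr mulr0 expr0n /= mul0r sub0r -(opprB u s) mulrN mulVf// sqrrN expr1n mul1r.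
by rewrite exprVn lerNl; apply.
Qed.

(** The difference of the two sides is constant because H is symmetric, and it
    vanishes at a. *)
Lemma jacobi_wronskian (H A Ap : R -> 'M[R]_n) (a b : R) :
  (forall t, (H t)^T = H t) -> A a = 0 ->
  (forall t, t \in `[a, b] -> is_derive t 1 A (Ap t)) ->
  (forall t, t \in `[a, b] -> is_derive t 1 Ap (- (A t *m H t))) ->
  forall t, t \in `[a, b] -> Ap t *m (A t)^T = A t *m (Ap t)^T.
Proof.
move=> symH Aa hA hAp t tab.
pose W t := Ap t *m (A t)^T - A t *m (Ap t)^T.
have sub s : s \in `[a, t] -> s \in `[a, b].
  move: tab; rewrite !in_itv/= => /andP[_ tb] /andP[-> st] /=.
  exact: le_trans tb.
have dW s : s \in `[a, t] -> is_derive s 1 W 0.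
  move=> /sub sI; have hAs := hA s sI; have hAps := hAp s sI.
  apply: (is_derive_eq (is_deriveB
    (is_derive_mulmx _ _ _ _ _ hAps (is_derive_trmx _ _ _ hAs))
    (is_derive_mulmx _ _ _ _ _ hAs (is_derive_trmx _ _ _ hAps)))).
  rewrite linearN /= trmx_mul symH mulmxN mulNmx !mulmxA.
  by apply/matrixP => i j; rewrite !mxE; ring.
have at_ : a <= t by move: tab; rewrite in_itv/= => /andP[].
have W0 s : s \in `[a, t] -> `|0 : 'M[R]_n| <= 0 :> R by rewrite normr0.
have := norm_le_of_derive_le W (fun=> 0) (fun=> 0) (fun=> 0) a t at_ dW
  (fun s _ => is_derive_cst (0:R) s (1:R)) W0.
rewrite subrr.
by rewrite normr_le0 {2}/W Aa linear0 mul0mx mulmx0 !subr0 subr_eq0 => /eqP.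
Qed.

Lemma jacobi_riccati_sym (A Ap : 'M[R]_n) : A \in unitmx ->
  Ap *m A^T = A *m Ap^T -> (invmx A *m Ap)^T = invmx A *m Ap.
Proof.
move=> Au e; rewrite trmx_mul trmx_inv -[LHS](mulKmx Au) (mulmxA A) -e.
by rewrite -(mulmxA Ap) mulmxV ?unitmx_tr// mulmx1.
Qed.

Lemma jacobi_riccati (H A Ap : R -> 'M[R]_n) (t : R) : A t \in unitmx ->
  is_derive t 1 A (Ap t) -> is_derive t 1 Ap (- (A t *m H t)) ->
  let U s := invmx (A s) *m Ap s in
  is_derive t 1 U (- (U t *m U t) - H t).
Proof.
move=> At hA hAp U.
apply: (is_derive_eq (is_derive_mulmx _ _ _ _ _ (is_derive_invmx A _ t At hA) hAp)).
by rewrite mulmxN mulKmx// mulNmx !mulmxA.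
Qed.

(** If A stayed invertible, U = A^-1 A' would have tr U <= n / La at t0 - d and
    tr U >= - n / La at t0 + d, where La is the distance to the ends of [p, r].
    The test curve 1 + eps psi K, which is 1 at t0 - d and at t0 + d, forces tr U
    to drop by at least m between these times, with m independent of La. *)
Lemma conjugate_points_exist (H : R -> 'M[R]_n) (t0 : R) :
  continuous H -> (forall t, (H t)^T = H t) -> (forall t, 0 <= \tr (H t)) ->
  H t0 != 0 ->
  exists a b, a < b /\ forall A Ap : R -> 'M[R]_n, A a = 0 -> Ap a = 1%:M ->
    (forall t, t \in `[a, b] -> is_derive t 1 A (Ap t)) ->
    (forall t, t \in `[a, b] -> is_derive t 1 Ap (- (A t *m H t))) ->
    exists t, [/\ a < t, t <= b & A t \notin unitmx].
Proof.
have absurd (x y z w : R) : x <= y -> - y <= z -> 2 * y < w -> z - x <= - w -> False.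
  by lra.
move=> cH symH trH H0n; set K := H t0 in H0n.
have symK : K^T = K by exact: symH.
pose kap := \tr (K *m K).
have kap0 : 0 < kap by rewrite /kap -{1}symK; exact: mxtrace_sqr_gt0.
have ctr (f : R -> 'M[R]_n) : continuous f -> continuous (fun t => \tr (f t)).
  move=> cf t; apply: (@cvg_big R 'I_n +%R 0 xpredT).
    exact: add_continuous.
  by move=> i _; have /mx_cvgP := cf t; apply.
have cHK : continuous (fun t => \tr (H t *m K)).
  by apply: ctr => t; apply: cvg_mulmx; [exact: cH|exact: cvg_cst].
have cKHK : continuous (fun t => \tr (K *m H t *m K)).
  apply: ctr => t; apply: cvg_mulmx; last exact: cvg_cst.
  by apply: cvg_mulmx; [exact: cvg_cst|exact: cH].
have [d0 d00 hd0] : exists2 d, 0 < d & forall t, `|t - t0| < d ->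
    kap / 2 <= \tr (H t *m K) /\ `|\tr (K *m H t *m K)| <= `|\tr (K *m K *m K)| + 1.
  have /cvgrPdist_lt /(_ (kap / 2)) h1 := cHK t0.
  have /cvgrPdist_lt /(_ 1 ltr01) [d2 /= d20 h2] := cKHK t0.
  have [d1 /= d10 {}h1] := h1 (divr_gt0 kap0 (ltr0Sn _ 1)).
  exists (Num.min d1 d2); first by rewrite lt_min d10.
  move=> t; rewrite lt_min => /andP[t1 t2]; split.
    have := h1 t; rewrite /= distrC => /(_ t1); rewrite -/K -/kap ltr_norml; lra.
  have := h2 t; rewrite /= distrC => /(_ t2); rewrite -/K.
  move: (\tr (K *m H t *m K)) (\tr (K *m K *m K)) => u w.
  by have := ler_normD (u - w) w; rewrite subrK distrC; lra.
pose B := `|\tr (K *m K *m K)| + 1.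
have B0 : 0 < B by rewrite ltr_wpDl.
pose d := d0 / 2.
have dpos : 0 < d by rewrite divr_gt0.
have hd t : t \in `[t0 - d, t0 + d] ->
    kap / 2 <= \tr (H t *m K) /\ `|\tr (K *m H t *m K)| <= B.
  rewrite in_itv /= => /andP[t1 t2]; apply: hd0.
  by rewrite ltr_norml /d in t1 t2 *; apply/andP; split; lra.
(* With this eps the terms of order two in eps integrate to half of the gain
   4/3 eps kap d^3 of order one; m is the other half. *)
pose eps := kap / (3 * (4 * kap + d ^+ 2 * B)).
have den0 : 0 < 4 * kap + d ^+ 2 * B.
  by rewrite addr_gt0// mulr_gt0// exprn_gt0.
have eps0 : 0 < eps by rewrite divr_gt0// mulr_gt0.
pose m := 2 / 3 * eps * kap * d ^+ 3.
have m0 : 0 < m.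
  have h : 0 < eps * kap * d ^+ 3 by apply: mulr_gt0 (mulr_gt0 eps0 kap0) _; exact: exprn_gt0.
  by rewrite /m; move: (eps) (kap) (d ^+ 3) h => e k f h; lra.
pose N := n%:R : R.
have N0 : 0 <= N by rewrite ler0n.
pose La := 2 * N / m + 1.
have La0 : 0 < La.
  by apply: ltr_wpDl => //; apply: divr_ge0; [exact: mulr_ge0|exact: ltW].
have NLa : 2 * (N / La) < m.
  rewrite mulrA ltr_pdivrMr// (_ : m * La = 2 * N + m) ?ltrDl//.
  by rewrite /La; field; rewrite gt_eqF.
pose p := t0 - d - La; pose r := t0 + d + La.
(* A vanishes at p - 1, so that U is defined on the closed interval [p, r]. *)
exists (p - 1), r; split; first by rewrite /p /r; lra.
move=> A Ap Aa Apa hA hAp; apply: contrapT => nex.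
have Aunit t : t \in `[p, r] -> A t \in unitmx.
  rewrite in_itv/= => /andP[pt tr]; apply/negPn/negP => nA; apply: nex.
  by exists t; split=> //; lra.
have sub t : t \in `[p, r] -> t \in `[p - 1, r].
  by rewrite !in_itv/= => /andP[pt ->]; rewrite andbT; lra.
pose U t := invmx (A t) *m Ap t.
have dU t : t \in `[p, r] -> is_derive t 1 U (- (U t *m U t) - H t).
  by move=> tpr; apply: jacobi_riccati; [exact: Aunit|exact: hA (sub t tpr)|
    exact: hAp (sub t tpr)].
have symU t : t \in `[p, r] -> (U t)^T = U t.
  move=> tpr; apply: jacobi_riccati_sym; first exact: Aunit.
  exact: jacobi_wronskian symH Aa hA hAp t (sub t tpr).
have sub3 s u : p <= s -> u <= r -> forall t, t \in `[s, u] -> t \in `[p, r].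
  by move=> ps ur t; rewrite !in_itv/= => /andP[st tu]; apply/andP; split; lra.
have trb s u (ps : p <= s) (ur : u <= r) (su : s < u) := riccati_trace_bounds U H s u su
  (fun t h => symU t (sub3 s u ps ur t h)) (fun t h => dU t (sub3 s u ps ur t h)) trH.
have [||u1 _] := trb p (t0 - d) (lexx _); [by rewrite /r; lra|by rewrite /p; lra|].
have [||_ u2] := trb (t0 + d) r _ (lexx _); [by rewrite /p; lra|by rewrite /r; lra|].
have e1 : t0 - d - p = La by rewrite /p; ring.
have e2 : r - (t0 + d) = La by rewrite /r; ring.
pose psi t := d ^+ 2 - (t - t0) ^+ 2.
pose E := eps ^+ 2 * (4 * d ^+ 2 * kap + d ^+ 4 * B).
(* g is the explicit primitive of the bound dg on the derivative of tr (M U M). *)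
pose g t := E * t - eps * kap * (d ^+ 2 * t - (t - t0) ^+ 3 / 3).
pose dg t := E - eps * kap * psi t.
have dle : t0 - d <= t0 + d by lra.
have pd : p <= t0 - d by rewrite /p; lra.
have dr : t0 + d <= r by rewrite /r; lra.
have dlin (t : R) : is_derive t (1:R) (fun t => t - t0) 1.
  by apply: (is_derive_eq (is_deriveB (is_derive_id t (1:R)) (is_derive_cst t0 t (1:R)))); rewrite subr0.
have dpsi (t : R) : is_derive t (1:R) psi (- 2 * (t - t0)).
  apply: (is_derive_eq (is_deriveB (is_derive_cst (d ^+ 2) t (1:R)) (is_derive_pow _ _ _ 2 (dlin t)))).
  by rewrite sub0r /= expr1 mulr1 mulNr.
have dg_ (t : R) : is_derive t (1:R) g (dg t).
  have h1 := is_derive_Mr _ _ _ E (is_derive_id t (1:R)).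
  have h2 := is_derive_Mr _ _ _ (d ^+ 2) (is_derive_id t (1:R)).
  have h3 := is_derive_Mr _ _ _ 3^-1 (is_derive_pow _ _ _ 3 (dlin t)).
  have h4 := is_derive_Mr _ _ _ (eps * kap) (is_deriveB h2 h3).
  rewrite (_ : g = (fun t => t * E) - (fun t => (t * d ^+ 2 - (t - t0) ^+ 3 / 3) * (eps * kap))).
    apply: (is_derive_eq (is_deriveB h1 h4)); rewrite /dg /psi /=.
    by field.
  by apply/funext => w; rewrite /g !fctE; ring.
pose M t := 1%:M + (eps * psi t) *: K.
pose dM t := (eps * (- 2 * (t - t0))) *: K.
have hM t : t \in `[t0 - d, t0 + d] -> is_derive t (1:R) M (dM t).
  move=> _; have hs := is_derive_scalemx _ _ K t (is_derive_Mr _ _ _ eps (dpsi t)).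
  have := is_deriveD (is_derive_cst (1%:M : 'M[R]_n) t (1:R)) hs.
  rewrite add0r /dM mulrC.
  by rewrite (_ : _ + _ = M)//; apply/funext => w; rewrite /M mulrC.
have symM t : (M t)^T = M t by rewrite /M linearD /= trmx1 linearZ /= symK.
have symdM t : (dM t)^T = dM t by rewrite /dM linearZ /= symK.
have hle t : t \in `[t0 - d, t0 + d] ->
    \tr (dM t *m dM t) - \tr (M t *m H t *m M t) <= dg t.
  move=> tI; have [h1 h2] := hd t tI.
  have tI' : (t - t0) ^+ 2 <= d ^+ 2.
    rewrite -[(t - t0) ^+ 2]real_normK ?num_real// lerXn2r ?nnegrE ?(ltW dpos)//.
    by move: tI; rewrite in_itv ler_distl.
  have psi_ge0 : 0 <= psi t by rewrite subr_ge0.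
  have psi_le : psi t <= d ^+ 2 by rewrite /psi gerBl sqr_ge0.
  rewrite /dM /M /dg; move: (psi t) psi_ge0 psi_le => c c0 cd.
  rewrite !(mulmxDl, mulmxDr, mul1mx, mulmx1) -!(scalemxAl, scalemxAr) !scalerA.
  rewrite !linearD /= !mxtraceZ -/kap (mxtrace_mulC K (H t)).
  have tH := trH t; move: h1 h2; rewrite ler_norml => h1 /andP[h2 _].
  have q1 : 4 * eps ^+ 2 * (t - t0) ^+ 2 * kap <= 4 * eps ^+ 2 * d ^+ 2 * kap.
    by rewrite ler_wpM2r ?(ltW kap0)// ler_wpM2l// mulr_ge0 ?sqr_ge0.
  have q2 : eps * c * kap <= 2 * (eps * c) * \tr (H t *m K).
    have ec : 0 <= eps * c by apply: mulr_ge0 => //; exact: ltW.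
    by have := ler_wpM2l ec h1; lra.
  have q3 : - (eps ^+ 2 * d ^+ 4 * B) <= eps ^+ 2 * c ^+ 2 * \tr (K *m H t *m K).
    have ec : 0 <= eps ^+ 2 * c ^+ 2 by rewrite mulr_ge0// sqr_ge0.
    apply: le_trans (ler_wpM2l ec h2); rewrite mulrN lerN2 ler_wpM2r ?(ltW B0)//.
    rewrite ler_wpM2l ?sqr_ge0// -[4%N]/(2 * 2)%N exprM lerXn2r ?nnegrE ?sqr_ge0//.
  by rewrite /E; move: q1 q2 q3 h1 h2 tH; lra.
have := riccati_test_le U M H dM g dg (t0 - d) (t0 + d) dle
  (fun t h => symU t (sub3 _ _ pd dr t h)) (fun t h => dU t (sub3 _ _ pd dr t h))
  hM symM symdM (fun t _ => dg_ t) hle.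
have psi1 : psi (t0 - d) = 0 by rewrite /psi; ring.
have psi2 : psi (t0 + d) = 0 by rewrite /psi; ring.
rewrite /M psi1 psi2 mulr0 scale0r addr0 !mul1mx !mulmx1.
have -> : g (t0 + d) - g (t0 - d) = - m.
  have -> : g (t0 + d) - g (t0 - d) = 2 * d * E - 4 / 3 * (eps * kap * d ^+ 3).
    by rewrite /g; field.
  rewrite /m /E.
  have -> : eps ^+ 2 * (4 * d ^+ 2 * kap + d ^+ 4 * B) = eps * kap * d ^+ 2 / 3.
    by rewrite /eps; field; rewrite gt_eqF.
  by field.
move: u1 u2; rewrite e1 e2 => u1 u2 u3.
exact: absurd u1 u2 NLa u3.
Qed.
End riccati.

(** * Mixed second derivatives, and tubes around curves *)

Lemma is_derive_line {R : realType} {W : normedModType R} (f : W -> R) (p v : W) (tau : R) :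
  derivable f (p + tau *: v) v ->
  is_derive tau (1:R) (fun t => f (p + t *: v)) ('D_v f (p + tau *: v)).
Proof.
move=> df.
have e : (fun h : R => h^-1 *: (f (p + (h *: (1:R) + tau) *: v) - f (p + tau *: v)))
       = (fun h : R => h^-1 *: (f (h *: v + (p + tau *: v)) - f (p + tau *: v))).
  apply/funext => h; congr (_ *: (f _ - _)).
  by rewrite [h *: 1]mulr1 scalerDl addrCA.
by split; rewrite /derivable /derive /= e.
Qed.

Lemma mean_value_line {R : realType} {W : normedModType R} (f : W -> R) (p v : W) (h : R) :
  0 <= h -> (forall t, 0 <= t <= h -> derivable f (p + t *: v) v) ->
  exists2 c, 0 <= c <= h & f (p + h *: v) - f p = 'D_v f (p + c *: v) * h.
Proof.
move=> h0 df; pose F t := f (p + t *: v).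
have dF t : t \in `[0, h] -> is_derive t (1:R) F ('D_v f (p + t *: v)).
  by rewrite in_itv/= => th; apply: is_derive_line; exact: df.
have dF' t : t \in `]0, h[ -> is_derive t (1:R) F ('D_v f (p + t *: v)).
  by move=> /subset_itv_oo_cc; exact: dF.
have cF : {within `[0, h], continuous F}.
  by apply: derivable_within_continuous => t /dF [].
have [c] := MVT_segment h0 dF' cF.
by rewrite in_itv/= /F scale0r addr0 subr0 => ? ?; exists c.
Qed.

Lemma near_plane {R : realType} {W : normedModType R} (p u v : W) (P : W -> Prop) :
  (\forall q \near p, P q) ->
  exists2 d, 0 < d & forall a b : R, `|a| <= d -> `|b| <= d -> P (p + a *: u + b *: v).
Proof.
move=> /nbhs_ballP [e /= e0 he]; pose s := `|u| + `|v| + 1.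
have s0 : 0 < s by rewrite ltr_wpDl// addr_ge0.
exists (e / (2 * s)); first by rewrite divr_gt0// mulr_gt0.
move=> a b ha hb; apply: he; rewrite -ball_normE /= -addrA opprD addrA subrr add0r normrN.
apply: (le_lt_trans (ler_normD _ _)); rewrite !normrZ.
have h1 : `|a| * `|u| + `|b| * `|v| <= e / (2 * s) * s.
  rewrite /s mulrDr mulr1 mulrDr; apply: ler_wpDr.
    by rewrite divr_ge0 ?(ltW e0)// mulr_ge0// addr_ge0// addr_ge0.
  by apply: lerD; apply: ler_wpM2r.
apply: le_lt_trans h1 _.
by rewrite (_ : e / (2 * s) * s = e / 2); [lra|field; rewrite gt_eqF].
Qed.

(** The mean value theorem, applied to the increment of f along v as a function
    of the displacement along u, and then to 'D_u f along v. *)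
Lemma second_difference {R : realType} {W : normedModType R} (f : W -> R) (p u v : W) (h : R) :
  0 <= h ->
  (forall a b, 0 <= a <= h -> 0 <= b <= h ->
    derivable f (p + a *: u + b *: v) u /\ derivable ('D_u f) (p + a *: u + b *: v) v) ->
  exists a b, [/\ 0 <= a <= h, 0 <= b <= h &
    f (p + h *: u + h *: v) - f (p + h *: u) - f (p + h *: v) + f p =
    'D_v ('D_u f) (p + a *: u + b *: v) * h ^+ 2].
Proof.
move=> h0 df; have hh : 0 <= h <= h by rewrite h0 lexx.
have h00 : (0 : R) <= 0 <= h by rewrite h0 lexx.
pose k t := f (p + t *: u + h *: v) - f (p + t *: u).
have dk t : t \in `[0, h] -> is_derive t (1:R) k
    ('D_u f (p + t *: u + h *: v) - 'D_u f (p + t *: u)).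
  rewrite in_itv/= => th; apply: is_deriveB.
    have e w : p + w *: u + h *: v = p + h *: v + w *: u by rewrite addrAC.
    under eq_fun do rewrite e; rewrite e; apply: is_derive_line.
    by rewrite -e; apply: (df t h th hh).1.
  apply: is_derive_line; have := (df t 0 th h00).1.
  by rewrite scale0r addr0.
have dk' t : t \in `]0, h[ -> is_derive t (1:R) k
    ('D_u f (p + t *: u + h *: v) - 'D_u f (p + t *: u)).
  by move=> /subset_itv_oo_cc; exact: dk.
have ck : {within `[0, h], continuous k}.
  by apply: derivable_within_continuous => t /dk [].
have [a] := MVT_segment h0 dk' ck; rewrite in_itv/= => ah e.
have [|b bh e2] := mean_value_line ('D_u f) (p + a *: u) v h h0.
  by move=> t th; apply: (df a t ah th).2.
exists a, b; split=> //; rewrite expr2 mulrA -e2.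
by move: e; rewrite subr0 /k scale0r addr0 => <-; ring.
Qed.

(** Schwarz: the second difference is symmetric in u and v, and it computes both
    mixed derivatives at points arbitrarily close to p. *)
Lemma derive_comm {R : realType} {W : normedModType R} (A : set W) (f : W -> R) (u v p : W) :
  open A -> C2_on A f -> A p -> 'D_u ('D_v f) p = 'D_v ('D_u f) p.
Proof.
move=> oA [[df _] C2] Ap; apply/eqP; rewrite -subr_eq0 -normr_eq0 eq_le normr_ge0 andbT.
apply/ler_addgt0Pr => e e0; rewrite add0r.
have e2 : 0 < e / 2 by rewrite divr_gt0.
have nA : \forall q \near p, A q by exact: open_nbhs_nbhs.
have /cvgrPdist_le /(_ _ e2) n1 := (C2 v).2 u p Ap.
have /cvgrPdist_le /(_ _ e2) n2 := (C2 u).2 v p Ap.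
have [d d0 hd] := near_plane p u v _ (filterI nA (filterI n1 n2)).
have d_ge0 : 0 <= d by exact: ltW.
have small a : 0 <= a <= d -> `|a| <= d.
  by move=> /andP[a0 ad]; rewrite ger0_norm.
have [|a [b [ah bh E1]]] := second_difference f p u v d d_ge0.
  move=> a b ah bh; have [Aq _] := hd a b (small a ah) (small b bh).
  by split; apply: diff_derivable; [exact: df|exact: (C2 u).1].
have [|b' [a' [bh' ah' E2]]] := second_difference f p v u d d_ge0.
  move=> b' a' bh' ah'; have [Aq _] := hd a' b' (small a' ah') (small b' bh').
  rewrite addrAC in Aq.
  by split; apply: diff_derivable; [exact: df|exact: (C2 v).1].
have [_ [_ /= q1]] := hd a b (small a ah) (small b bh).
have [_ [/= q2 _]] := hd a' b' (small a' ah') (small b' bh').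
have E : 'D_v ('D_u f) (p + a *: u + b *: v) = 'D_u ('D_v f) (p + a' *: u + b' *: v).
  apply: (@mulIf _ (d ^+ 2)); first by rewrite expf_neq0// gt_eqF.
  rewrite [p + d *: v + d *: u]addrAC [p + b' *: v + a' *: u]addrAC in E2.
  by apply: (etrans (esym E1)); apply: (etrans _ E2); congr (_ + _); exact: addrAC.
rewrite E in q1.
apply: le_trans (ler_distD ('D_u ('D_v f) (p + a' *: u + b' *: v)) _ _) _.
by rewrite [leRHS]splitr; apply: lerD; [exact: q2|rewrite distrC; exact: q1].
Qed.

(** A relation that holds between points close to (t, x t), for each t, holds
    between (t, z) and (t, x t) for z within a distance d independent of t, by
    compactness of [a, b].  It yields both a tube contained in an open set and
    uniform continuity along a curve. *)
Lemma tube {R : realType} {W : normedModType R} (x : R -> W) (a b : R)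
    (Q : R * W -> R * W -> Prop) :
  (forall t, t \in `[a, b] -> {for t, continuous x}) ->
  (forall t, t \in `[a, b] -> exists2 e, 0 < e &
     forall p q, `|p.1 - t| < e -> `|p.2 - x t| < e ->
       `|q.1 - t| < e -> `|q.2 - x t| < e -> Q p q) ->
  exists2 d, 0 < d & forall t, t \in `[a, b] -> forall z, `|z - x t| <= d ->
    Q (t, z) (t, x t).
Proof.
move=> cx hQ.
have /compact_near_coveringP K := @segment_compact R a b.
pose P (d : R) t := forall z, `|z - x t| <= d -> Q (t, z) (t, x t).
have [|d /= d0 hd] := K R (0^'+) P _.
  move=> t tab; have [e e0 he] := hQ t tab.
  have e2 : 0 < e / 2 by rewrite divr_gt0.
  have /cvgrPdist_lt /(_ _ e2) nx := cx t tab.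
  near=> t' d => z zd.
  have h1 : `|t' - t| < e by near: t'; exists e => //= w; rewrite distrC.
  have h2 : `|x t - x t'| < e / 2 by near: t'.
  have h3 : d < e / 2 by near: d; exact: nbhs_right_lt.
  apply: he => //=.
    apply: le_lt_trans (ler_distD (x t') _ _) _.
    rewrite (distrC (x t')) [ltRHS](splitr e) ltrD//; exact: le_lt_trans h3.
  by rewrite distrC; lra.
exists (d / 2); first by rewrite divr_gt0.
move=> t tab; apply: (hd (d / 2)) => //=.
  by rewrite sub0r normrN ger0_norm; lra.
by rewrite divr_gt0.
Unshelve. all: by end_near. Qed.

(** * The gradient and the Hessian of the potential *)

Definition hess_mx {R : realType} {n : nat} (V : R * 'rV[R]_n -> R) (p : R * 'rV[R]_n) : 'M[R]_n :=
  \matrix_(i, j) hess_x V p i j.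

Section potential.
Context {R : realType} {n : nat}.
Variables (A : set (R * 'rV[R]_n)) (V : R * 'rV[R]_n -> R).
Hypotheses (oA : open A) (VC2 : C2_on A V).

Lemma hess_mx_sym p : A p -> (hess_mx V p)^T = hess_mx V p.
Proof.
by move=> Ap; apply/matrixP => i j; rewrite !mxE; exact: (derive_comm A).
Qed.

Lemma hess_mx_continuous p : A p -> {for p, continuous (hess_mx V)}.
Proof.
move=> Ap; apply/(mx_cvgP (FF := nbhs_filter p)) => i j.
have -> : hess_mx V p i j = hess_x V p i j by exact: mxE.
under eq_fun do rewrite mxE.
exact: (VC2.2 _).2.
Qed.

Lemma grad_x_continuous p : A p -> {for p, continuous (grad_x V)}.
Proof.
move=> Ap; apply/(mx_cvgP (FF := nbhs_filter p)) => i j.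
rewrite [grad_x V p i j]mxE.
under eq_fun do rewrite mxE.
exact: VC2.1.2.
Qed.

Lemma derive_x_expand (f : R * 'rV[R]_n -> R) p (w : 'rV[R]_n) : differentiable f p ->
  'D_(0, w) f p = \sum_j w 0 j * 'D_(0, delta_mx 0 j) f p.
Proof.
move=> df; rewrite deriveE//.
have -> : (0, w) = \sum_j w 0 j *: ((0 : R), (delta_mx 0 j : 'rV[R]_n)).
  rewrite {1}[w]row_sum_delta.
  elim/big_rec2: _ => [//|j y1 y2 _ <-].
  by congr (_, _); rewrite /= scaler0 add0r.
rewrite linear_sum; apply: eq_bigr => j _.
by rewrite linearZ deriveE.
Qed.

(** With [mean_value_line] applied to each component of the gradient; the
    intermediate point depends on the component. *)
Lemma grad_x_mean_value (t : R) (y z : 'rV[R]_n) :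
  (forall th, 0 <= th <= 1 -> A (t, y + th *: (z - y))) ->
  forall i, exists2 th, 0 <= th <= 1 &
    (grad_x V (t, z) - grad_x V (t, y)) 0 i =
    ((z - y) *m hess_mx V (t, y + th *: (z - y))) 0 i.
Proof.
move=> hA i.
have lineE th : (t, y) + th *: ((0 : R), z - y) = (t, y + th *: (z - y)).
  by congr (_, _); rewrite /= scaler0 addr0.
have [|th th01 e] := mean_value_line (partial_x i V) (t, y) (0, z - y) 1 ler01.
  move=> th h; rewrite lineE; apply: diff_derivable.
  by apply: (VC2.2 _).1; exact: hA.
exists th => //; move: e; rewrite !lineE scale1r (addrC y) subrK mulr1 !mxE => ->.
rewrite derive_x_expand; last by apply: (VC2.2 _).1; exact: hA.
by apply: eq_bigr => j _; rewrite !mxE.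
Qed.

End potential.

Lemma mulmx_norm_le {R : realType} {n : nat} (w : 'rV[R]_n) (M : 'M[R]_n) :
  `|w *m M| <= n%:R * `|M| * `|w|.
Proof.
apply/mx_norm_leP; first by rewrite !mulr_ge0.
move=> i j; rewrite mxE; apply: le_trans (ler_norm_sum _ _ _) _.
rewrite -mulrA mulr_natl -[X in _ *+ X]card_ord -sumr_const.
by apply: ler_sum => k _; rewrite normrM mulrC ler_pM// mx_entry_le.
Qed.

(** The nearest point of the closed ball of radius r for the sup norm; working
    entry by entry makes it 1-Lipschitz for that norm. *)
Definition clampv {R : realType} {n : nat} (r : R) (y : 'rV[R]_n) : 'rV[R]_n :=
  \row_i clamp (- r) r (y 0 i).

Section clampv.
Context {R : realType} {n : nat}.
Implicit Types (r : R) (y z : 'rV[R]_n).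

Lemma clampv_le r y : 0 <= r -> `|clampv r y| <= r.
Proof.
move=> r0; apply/mx_norm_leP => // i j; rewrite mxE ler_norml.
have rr : - r <= r by lra.
by have := clamp_itv (- r) r (y 0 j) rr; rewrite in_itv.
Qed.

Lemma clampv_id r y : `|y| <= r -> clampv r y = y.
Proof.
move=> yr; apply/rowP => i; rewrite mxE clamp_id// in_itv /= -ler_norml.
exact: le_trans (mx_entry_le _ _ _) yr.
Qed.

Lemma clampv_dist r y z : `|clampv r y - clampv r z| <= `|y - z|.
Proof.
apply/mx_norm_leP => // i j; rewrite !mxE; apply: le_trans (clamp_dist _ _ _ _) _.
by have := mx_entry_le (y - z) 0 j; rewrite !mxE.
Qed.

Lemma clampv_continuous r : continuous (@clampv R n r).
Proof.
move=> y; apply/(mx_cvgP (FF := nbhs_filter (y : 'rV[R]_n))) => i j.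
rewrite mxE; under eq_fun do rewrite mxE.
apply: (@continuous_comp _ _ _ (fun z : 'rV[R]_n => z 0 j) (clamp (- r) r)).
  exact: coord_continuous.
exact: clamp_continuous.
Qed.

End clampv.

(** * Solutions near a given solution *)

Lemma continuous_pair {S T T' : topologicalType} (f : S -> T) (g : S -> T') (p : S) :
  {for p, continuous f} -> {for p, continuous g} ->
  {for p, continuous (fun s => (f s, g s))}.
Proof.
exact: (@cvg_pair _ _ _ (nbhs p) (nbhs (f p)) (nbhs (g p)) _ _ _ f g).
Qed.

Section solution_family.
Context {R : realType} {n : nat}.
Variables (A : set (R * 'rV[R]_n)) (V : R * 'rV[R]_n -> R).
Hypotheses (oA : open A) (VC2 : C2_on A V).
Variables (x : R -> 'rV[R]_n) (a b : R).
Hypothesis ab : a < b.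
Hypothesis cx : forall t, t \in `[a, b] -> {for t, continuous x}.
Hypothesis xA : forall t, t \in `[a, b] -> A (t, x t).

Let ab' : a <= b. Proof. exact: ltW. Qed.

Lemma continuous_along (T : topologicalType) (f : R * 'rV[R]_n -> T) t :
  t \in `[a, b] -> {for (t, x t), continuous f} ->
  {for t, continuous (fun s => f (s, x s))}.
Proof.
move=> tab cf; apply: (@continuous_comp _ _ _ (fun s => (s, x s)) f) => //.
by apply: continuous_pair; [exact: cvg_id|exact: cx].
Qed.

Lemma tube_hess_bound : exists r L, [/\ 0 < r, 0 <= L & forall t, t \in `[a, b] ->
  forall y, `|y| <= r -> A (t, x t + y) /\
    forall w : 'rV[R]_n, `|w *m hess_mx V (t, x t + y)| <= L * `|w|].
Proof.
have [|d d0 hd] := tube x a b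
  (fun p q => A p /\ `|hess_mx V p - hess_mx V q| <= 1) cx; last first.
  have [B B0 hB] := continuous_bounded_itv (fun t => hess_mx V (t, x t)) a b
    (fun t h => continuous_along _ _ t h (hess_mx_continuous A V VC2 _ (xA t h))).
  exists d, (n%:R * (B + 1)); split=> //.
    by rewrite mulr_ge0// addr_ge0.
  move=> t tab y yd; have [|Ay hy] := hd t tab (x t + y).
    by rewrite addrAC subrr add0r.
  split=> // w; apply: le_trans (mulmx_norm_le _ _) _.
  rewrite ler_wpM2r// ler_wpM2l//.
  rewrite -[X in `|X|](subrK (hess_mx V (t, x t))).
  by apply: le_trans (ler_normD _ _) _; rewrite addrC lerD// hB.
move=> t tab.
have nA : \forall p \near (t, x t), A p.
  by apply: open_nbhs_nbhs; split=> //; exact: xA.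
have half0 : (0 : R) < 2^-1 by rewrite invr_gt0.
have /cvgrPdist_le /(_ _ half0) nH := hess_mx_continuous A V VC2 _ (xA t tab).
have : \forall p \near (t, x t), A p /\ `|hess_mx V (t, x t) - hess_mx V p| <= 2^-1.
  exact: filterI nA nH.
move=> /nbhs_ballP [e /= e0 he].
exists e => // p q p1 p2 q1 q2.
have bp : ball (t, x t) e p.
  by split; rewrite -ball_normE /= distrC.
have bq : ball (t, x t) e q.
  by split; rewrite -ball_normE /= distrC.
have [Ap hp] := he p bp; have [_ hq] := he q bq; split=> //.
apply: le_trans (ler_distD (hess_mx V (t, x t)) _ _) _.
rewrite [leRHS](splitr 1) mul1r; apply: lerD; last exact: hq.
by rewrite distrC; exact: hp.
Qed.

(** The equation for Y = X - x has force g (t, Y), the difference of the gradients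
    at x + Y and at x.  Replacing Y by its truncation to the ball of radius r,
    and t by its truncation to [a, b], makes g and its derivative H continuous
    everywhere and g globally Lipschitz, without changing them as long as
    Y stays in the ball. *)
Lemma solution_family (v : 'rV[R]_n) :
  exists e (Y Yp Z Zp : R -> R -> 'rV[R]_n), [/\ 0 < e,
    (forall t, t \in `[a, b] -> Y 0 t = 0),
    (forall s, `|s| < e -> [/\ Y s a = 0, Yp s a = s *: v &
      forall t, t \in `[a, b] -> [/\ is_derive t 1 (Y s) (Yp s t),
        is_derive t 1 (Yp s) (- (grad_x V (t, x t + Y s t) - grad_x V (t, x t))) &
        A (t, x t + Y s t)]]),
    (forall s, `|s| < e -> [/\ Z s a = 0, Zp s a = v &
      forall t, t \in `[a, b] -> [/\ is_derive t 1 (Z s) (Zp s t),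
        is_derive t 1 (Zp s) (- (Z s t *m hess_mx V (t, x t + Y s t))) &
        is_derive s 1 (Y ^~ t) (Z s t)]]) &
    forall s t, `|s| < e -> t \in `[a, b] -> forall eps, 0 < eps ->
      exists2 d, 0 < d & forall s' t', `|s'| < e -> t' \in `[a, b] ->
        `|s' - s| < d -> `|t' - t| < d -> `|Z s' t' - Z s t| <= eps].
Proof.
have [r [L [r0 L0 hrL]]] := tube_hess_bound.
(* Phi retracts everything into the tube, where V is C^2; Psi is the point of
   the reference curve at the same time. *)
pose Phi (p : R * 'rV[R]_n) := (clamp a b p.1, x (clamp a b p.1) + clampv r p.2).
have PhiA p : A (Phi p).
  by apply: (hrL _ (clamp_itv a b p.1 ab') _ (clampv_le _ _ (ltW r0))).1.
have cxc := continuous_comp_clamp a b x ab' cx.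
have cPhi : continuous Phi.
  move=> p; apply: (continuous_pair (fun p : R * 'rV[R]_n => clamp a b p.1)
    (fun p => x (clamp a b p.1) + clampv r p.2)).
    apply: (@continuous_comp _ _ _ fst (clamp a b)); first exact: cvg_fst.
    exact: clamp_continuous.
  apply: cvgD.
    apply: (@continuous_comp _ _ _ fst (fun t => x (clamp a b t))).
      exact: cvg_fst.
    exact: cxc.
  apply: (@continuous_comp _ _ _ snd (clampv r)); first exact: cvg_snd.
  exact: clampv_continuous.
pose Psi (p : R * 'rV[R]_n) := (clamp a b p.1, x (clamp a b p.1)).
have PsiA p : A (Psi p) by apply: xA; exact: clamp_itv.
have cPsi : continuous Psi.
  move=> p; apply: (continuous_pair (fun p : R * 'rV[R]_n => clamp a b p.1)
    (fun p => x (clamp a b p.1))).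
    apply: (@continuous_comp _ _ _ fst (clamp a b)); first exact: cvg_fst.
    exact: clamp_continuous.
  apply: (@continuous_comp _ _ _ fst (fun t => x (clamp a b t))).
    exact: cvg_fst.
  exact: cxc.
pose g t y := - (grad_x V (Phi (t, y)) - grad_x V (Psi (t, y))).
pose H t y := - hess_mx V (Phi (t, y)).
have cg : continuous (fun p => g p.1 p.2).
  move=> p; rewrite /g; apply: cvgN; apply: cvgB.
    apply: (@continuous_comp _ _ _ (fun p => Phi (p.1, p.2)) (grad_x V)).
      by case: p => p1 p2; exact: cPhi.
    by apply: grad_x_continuous VC2 _ _; exact: PhiA.
  apply: (@continuous_comp _ _ _ (fun p => Psi (p.1, p.2)) (grad_x V)).
    by case: p => p1 p2; exact: cPsi.
  by apply: grad_x_continuous VC2 _ _; exact: PsiA.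
have cH : continuous (fun p => H p.1 p.2).
  move=> p; rewrite /H; apply: cvgN.
  apply: (@continuous_comp _ _ _ (fun p => Phi (p.1, p.2)) (hess_mx V)).
    by case: p => p1 p2; exact: cPhi.
  by apply: hess_mx_continuous VC2 _ _; exact: PhiA.
have PhiE t y : t \in `[a, b] -> `|y| <= r -> Phi (t, y) = (t, x t + y).
  by move=> tab yr; rewrite /Phi /= clamp_id// clampv_id.
have PsiE t y : t \in `[a, b] -> Psi (t, y) = (t, x t).
  by move=> tab; rewrite /Psi /= clamp_id.
have Phi_clampv t y : Phi (t, clampv r y) = Phi (t, y).
  by rewrite /Phi /= (clampv_id _ (clampv r y))// clampv_le// ltW.
have clampE t y : Phi (clamp a b t, y) = Phi (t, y).
  by rewrite /Phi /= (clamp_id _ _ (clamp a b t))// clamp_itv.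
have PsiE' t y : Psi (clamp a b t, y) = Psi (t, y).
  by rewrite /Psi /= (clamp_id _ _ (clamp a b t))// clamp_itv.
have H_le t : t \in `[a, b] -> forall y (w : 'rV[R]_n), `|w *m H t y| <= L * `|w|.
  move=> tab y w; rewrite /H mulmxN normrN -Phi_clampv PhiE ?clampv_le ?(ltW r0)//.
  by apply: (hrL t tab _ _).2; rewrite clampv_le// ltW.
have g_mvt t : t \in `[a, b] -> forall y z, `|y| <= r -> `|z| <= r ->
    forall i, exists2 th, 0 <= th <= 1 &
    (g t z - g t y) 0 i = ((z - y) *m H t (y + th *: (z - y))) 0 i.
  move=> tab y z yr zr i.
  have conv th : 0 <= th <= 1 -> `|y + th *: (z - y)| <= r.
    move=> /andP[th0 th1].
    rewrite (_ : y + _ = (1 - th) *: y + th *: z); last first.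
      by rewrite scalerBr scalerBl scale1r addrA addrAC.
    apply: le_trans (ler_normD _ _) _; rewrite !normrZ ger0_norm ?subr_ge0// ger0_norm//.
    have := ler_wpM2l th0 zr; have th1' : 0 <= 1 - th by rewrite subr_ge0.
    have := ler_wpM2l th1' yr; lra.
  have diffE : x t + z - (x t + y) = z - y by rewrite opprD addrACA subrr add0r.
  have [|th th01 e] := grad_x_mean_value A V VC2 t (x t + y) (x t + z) _ i.
    move=> th th01; rewrite diffE -addrA.
    by apply: (hrL t tab _ _).1; exact: conv.
  exists th => //; rewrite /g /H !PhiE ?conv// !PsiE//.
  rewrite mulmxN [RHS]mxE; move: e; rewrite diffE -addrA => <-.
  by rewrite !mxE; ring.
have g_lip t : t \in `[a, b] -> forall y z, `|g t y - g t z| <= L * `|y - z|.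
  move=> tab y z.
  have gE w : g t w = g t (clampv r w) by rewrite /g Phi_clampv !PsiE.
  rewrite (gE y) (gE z); apply: (@le_trans _ _ (L * `|clampv r y - clampv r z|)).
    apply/mx_norm_leP; first by rewrite mulr_ge0.
    move=> i j; rewrite ord1.
    have [th _ ->] := g_mvt t tab (clampv r z) (clampv r y)
      (clampv_le _ _ (ltW r0)) (clampv_le _ _ (ltW r0)) j.
    by apply: le_trans (mx_entry_le _ _ _) _; exact: H_le.
  by rewrite ler_wpM2l// clampv_dist.
have g0 t : t \in `[a, b] -> g t 0 = 0.
  by move=> tab; rewrite /g PsiE// PhiE ?normr0 ?(ltW r0)// addr0 subrr oppr0.
have g_cont y : continuous y -> continuous (fun t => g (clamp a b t) (y t)).
  move=> cy; have -> : (fun t => g (clamp a b t) (y t)) = (fun t => g t (y t)).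
    by apply/funext => t; rewrite /g clampE PsiE'.
  move=> t; apply: (@continuous_comp _ _ _ (fun s => (s, y s)) (fun p => g p.1 p.2)).
    by apply: continuous_pair; [exact: cvg_id|exact: cy].
  exact: cg.
have H_cont y : continuous y -> continuous (fun t => H (clamp a b t) (y t)).
  move=> cy; have -> : (fun t => H (clamp a b t) (y t)) = (fun t => H t (y t)).
    by apply/funext => t; rewrite /H clampE.
  move=> t; apply: (@continuous_comp _ _ _ (fun s => (s, y s)) (fun p => H p.1 p.2)).
    by apply: continuous_pair; [exact: cvg_id|exact: cy].
  exact: cH.
have H_unif y : (forall t, t \in `[a, b] -> {for t, continuous y}) ->
    forall eps, 0 < eps -> exists2 d, 0 < d & forall t, t \in `[a, b] ->
    forall z, `|z - y t| <= d -> forall w : 'rV[R]_n,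
    `|w *m (H t z - H t (y t))| <= eps * `|w|.
  move=> cy eps eps0; pose eta := eps / (2 * (n%:R + 1)).
  have eta0 : 0 < eta by rewrite divr_gt0// mulr_gt0// ltr_wpDl.
  apply: (tube y a b (fun p q => forall w : 'rV[R]_n,
    `|w *m (H p.1 p.2 - H q.1 q.2)| <= eps * `|w|) cy) => t tab.
  have /cvgrPdist_le /(_ _ eta0) /nbhs_ballP [e /= e0 he] := cH (t, y t).
  exists e => // p q p1 p2 q1 q2 w.
  have hp : `|H t (y t) - H p.1 p.2| <= eta.
    by apply: he; split; rewrite -ball_normE /= distrC.
  have hq : `|H t (y t) - H q.1 q.2| <= eta.
    by apply: he; split; rewrite -ball_normE /= distrC.
  apply: le_trans (mulmx_norm_le _ _) _; rewrite ler_wpM2r//.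
  have h : `|H p.1 p.2 - H q.1 q.2| <= 2 * eta.
    have e2 : 2 * eta = eta + eta by ring.
    apply: le_trans (ler_distD (H t (y t)) _ _) _; rewrite e2.
    by apply: lerD; [rewrite (distrC (H p.1 p.2)); exact: hp|exact: hq].
  apply: (@le_trans _ _ (n%:R * (2 * eta))); first by rewrite ler_wpM2l.
  rewrite (_ : 2 * eta = eps / (n%:R + 1)); last first.
    by rewrite /eta; field; rewrite gt_eqF// ltr_wpDl.
  by rewrite mulrCA ler_piMr ?(ltW eps0)// ler_pdivrMr ?ltr_wpDl// mul1r lerDl.
have [e [Y [Yp [Z [Zp [e0 Y0 hY hZ hc]]]]]] := perturbation_family a b r L g H v ab' r0 L0
  g0 g_lip H_le g_mvt g_cont H_cont H_unif.
exists e, Y, Yp, Z, Zp; split=> //.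
  move=> s se; have [Ya Ypa h] := hY s se; split=> // t tab.
  have [h1 h2 h3] := h t tab; split=> //.
    by move: h2; rewrite /g PhiE ?(ltW h3)// PsiE.
  by apply: (hrL t tab _ _).1; exact: ltW.
move=> s se; have [Za Zpa h] := hZ s se; split=> // t tab.
have [h1 h2 h3] := h t tab; split=> //.
have [_ _ /(_ t tab) [_ _ Yr]] := hY s se.
by move: h2; rewrite /H PhiE ?(ltW Yr)// mulmxN.
Qed.

End solution_family.

(** * Derivatives relative to an interval *)

(** A function that is constant only to the right of a already has zero
    derivative at a: a nonzero initial velocity is seen on [a, b]. *)
Lemma is_derive_local_cst {R : realType} {W : normedModType R} (f : R -> W) (c l : W) (a b : R) :
  a < b -> is_derive a (1:R) f l -> (forall t, t \in `[a, b] -> f t = c) -> l = 0.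
Proof.
move=> ab [df <-] fc; apply/eqP; rewrite -normr_eq0 eq_le normr_ge0 andbT.
apply/ler_addgt0Pr => e e0; rewrite add0r.
have /cvgrPdist_le /(_ e e0) [d /= d0 hd] := df.
pose h := Num.min (d / 2) (b - a).
have h0 : 0 < h by rewrite lt_min divr_gt0//= subr_gt0.
have hd2 : h < d by rewrite gt_min; apply/orP; left; rewrite ltr_pdivrMr//; lra.
have hb : h <= b - a by rewrite ge_min lexx orbT.
have f1 : f (h + a) = c by apply: fc; rewrite in_itv/=; apply/andP; split; lra.
have f2 : f a = c by apply: fc; rewrite in_itv/= lexx ltW.
have := hd h; rewrite /= sub0r normrN (gtr0_norm h0) => /(_ hd2 (lt0r_neq0 h0)).
by rewrite -/('D_1 f a) [h *: 1]mulr1 f1 f2 subrr scaler0 subr0.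
Qed.

Section within.
Context {R : realType} {W : normedModType R}.

(** At the right endpoint increments are negative, at every other point they can
    be taken positive. *)
Lemma within_segment_proper (a b t : R) : a < b -> t \in `[a, b] ->
  ProperFilter (within [set h : R | `[a, b]%classic (h + t)] 0^').
Proof.
move=> ab; rewrite in_itv/= => /andP[at_ tb].
apply: Build_ProperFilter_ex => P [e /= e0 he].
have [lt_tb|le_bt] := ltP t b.
  pose h := Num.min (e / 2) (b - t).
  have h0 : 0 < h by rewrite lt_min divr_gt0//= subr_gt0.
  have h1 : h < e by rewrite gt_min; apply/orP; left; rewrite ltr_pdivrMr//; lra.
  have h2 : h <= b - t by rewrite ge_min lexx orbT.
  exists h; apply: he => /=.
  - by rewrite sub0r normrN gtr0_norm.
  - exact: lt0r_neq0.
  - by rewrite in_itv/=; apply/andP; split; lra.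
pose h := Num.min (e / 2) (b - a).
have h0 : 0 < h by rewrite lt_min divr_gt0//= subr_gt0.
have h1 : h < e by rewrite gt_min; apply/orP; left; rewrite ltr_pdivrMr//; lra.
have h2 : h <= b - a by rewrite ge_min lexx orbT.
exists (- h); apply: he => /=.
- by rewrite sub0r opprK gtr0_norm.
- by rewrite oppr_eq0; exact: lt0r_neq0.
- by rewrite in_itv/=; apply/andP; split; lra.
Qed.

Lemma cvg_diff_quot_within (J : set R) (f F : R -> W) (t : R) (l : W) : J t ->
  (forall u, J u -> f u = F u) -> is_derive t (1:R) F l ->
  diff_quot_within J f t --> l.
Proof.
move=> Jt fF [dF <-]; apply/cvgrPdist_le => e e0.
have /cvgrPdist_le /(_ e e0) := dF.
rewrite /within /prop_near1 /=; apply: filterS => h hh Jh.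
by rewrite !fF//; move: hh; rewrite [h *: 1]mulr1.
Qed.

Lemma derive_within_segment (a b t : R) (f F : R -> W) (l : W) : a < b -> t \in `[a, b] ->
  (forall u, u \in `[a, b] -> f u = F u) -> is_derive t (1:R) F l ->
  derivable_within `[a, b] f t /\ derive_within `[a, b] f t = l.
Proof.
move=> ab tab fF dF.
have h : diff_quot_within `[a, b] f t --> l.
  exact: cvg_diff_quot_within dF.
split; first by apply/cvg_ex; exists l.
have P := within_segment_proper a b t ab tab.
rewrite /diff_quot_within in h; rewrite /derive_within /diff_quot_within.
by apply: cvg_lim h; exact: norm_hausdorff.
Qed.

Lemma diff_quot_within_setT (f : R -> W) (t : R) :
  diff_quot_within setT f t = h^-1 *: (f (h *: (1:R) + t) - f t) @[h --> 0^'].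
Proof.
rewrite /diff_quot_within.
have -> : (fun h : R => h^-1 *: (f (h *: (1:R) + t) - f t)) =
    (fun h : R => h^-1 *: (f (h + t) - f t)).
  by apply/funext => h; rewrite [h *: 1]mulr1.
congr (_ @ _); apply/seteqP; split=> P; rewrite /within /=; apply: filterS => h.
  by apply.
by move=> Ph _.
Qed.

End within.

(** * From conjugate points to an accumulating family *)
Section conjugate_points_family.
Context {R : realType} {n : nat}.
Variables (I : set R) (U : set 'rV[R]_n) (V : R * 'rV[R]_n -> R).
Hypotheses (oA : open (I `*` U)) (VC2 : C2_on (I `*` U) V).
Variables (x x1 : R -> 'rV[R]_n).
Hypothesis dx : forall t, is_derive t (1:R) x (x1 t).
Hypothesis dx1 : forall t, is_derive t (1:R) x1 (- grad_x V (t, x t)).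
Hypothesis xA : forall t, (I `*` U) (t, x t).

(** The family is x + Y s with initial velocity varying in the direction Jp a.
    Its variation field solves the Jacobi equation with the same initial data as
    J, hence equals J.  Distinct parameters give distinct initial velocities,
    hence distinct solutions. *)
Lemma conjugate_points_family (a b : R) (J Jp : R -> 'rV[R]_n) : a < b ->
  (forall t, t \in `[a, b] -> is_derive t (1:R) J (Jp t)) ->
  (forall t, t \in `[a, b] -> is_derive t (1:R) Jp (- (J t *m hess_mx V (t, x t)))) ->
  J a = 0 -> J b = 0 -> Jp a != 0 ->
  exists e X, accumulating_family I U V x a b e X.
Proof.
move=> ab dJ dJp Ja Jb v0; set v := Jp a in v0.
have cx t : t \in `[a, b] -> {for t, continuous x}.
  by move=> _; exact: is_derive_continuous (dx t).
have xA' t : t \in `[a, b] -> (I `*` U) (t, x t) by [].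
have [e [Y [Yp [Z [Zp [e0 Y0 hY hZ hc]]]]]] :=
  solution_family (I `*` U) V oA VC2 x a b ab cx xA' v.
have [r [L [r0 L0 hrL]]] := tube_hess_bound (I `*` U) V oA VC2 x a b cx xA'.
have aab : a \in `[a, b] by rewrite in_itv/= lexx ltW.
have bab : b \in `[a, b] by rewrite in_itv/= lexx ltW.
have zle : `|0 : R| < e by rewrite normr0.
have HL t : t \in `[a, b] -> forall w : 'rV[R]_n, `|w *m hess_mx V (t, x t)| <= L * `|w|.
  move=> tab w; have := (hrL t tab 0 _).2 w; rewrite addr0; apply.
  by rewrite normr0 ltW.
have itvE s : (s \in `]- e, e[) = (`|s| < e) by rewrite in_itv/= ltr_norml.
have ZJ t : t \in `[a, b] -> Z 0 t = J t.
  move=> tab; have [Za Zpa hZ0] := hZ 0 zle.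
  have := @second_order_gronwall R 1 n (fun t => Z 0 t - J t) (fun t => Zp 0 t - Jp t)
    (fun t => - (Z 0 t *m hess_mx V (t, x t)) + J t *m hess_mx V (t, x t))
    a b L 0 0 L0 (lexx _) _ _ _ _ _ t tab.
  rewrite addr0 mulr0 => h; apply/eqP; rewrite -subr_eq0 -normr_le0; apply: h.
  - by move=> u uab; have [h1 _ _] := hZ0 u uab; apply: is_deriveB h1 (dJ u uab).
  - move=> u uab; have [_ h1 _] := hZ0 u uab; rewrite Y0// addr0 in h1.
    by apply: (is_derive_eq (is_deriveB h1 (dJp u uab))); rewrite opprK.
  - by rewrite Za Ja subrr.
  - by rewrite Zpa subrr normr0.
  - by move=> u uab; rewrite addr0 addrC -mulmxBl -normrN -mulNmx opprB HL.
pose X s t := x t + Y s t.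
have dX s t : `|s| < e -> t \in `[a, b] -> is_derive s (1:R) (X^~ t) (Z s t).
  move=> se tab; have [_ _ h] := hZ s se; have [_ _ h1] := h t tab.
  by apply: (is_derive_eq (is_deriveD (is_derive_cst (x t) s (1:R)) h1)); rewrite add0r.
have X1 s t : `|s| < e -> t \in `[a, b] -> derive1 (X^~ t) s = Z s t.
  by move=> se tab; rewrite derive1E; have [] := dX s t se tab.
exists e, X; split=> //.
- move=> s; rewrite itvE => se; have [Ya Ypa h] := hY s se.
  have d1 t : t \in `[a, b] -> is_derive t (1:R) (X s) (x1 t + Yp s t).
    by move=> tab; have [h1 _ _] := h t tab; exact: is_deriveD.
  have d2 t : t \in `[a, b] -> is_derive t (1:R) (fun u => x1 u + Yp s u) (- grad_x V (t, X s t)).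
    move=> tab; have [_ h1 _] := h t tab.
    by apply: (is_derive_eq (is_deriveD (dx1 t) h1)); rewrite opprB addKr.
  split.
  + exact: interval_is_interval.
  + by exists a, b.
  + by move=> t tab; have [] := h t tab.
  + move=> t tab.
    have h1 u (uab : u \in `[a, b]) := derive_within_segment a b u (X s) (X s) _ ab uab
      (fun _ _ => erefl) (d1 u uab).
    have [h2 h3] := derive_within_segment a b t (derive_within `[a, b] (X s)) _ _ ab tab
      (fun u uab => (h1 u uab).2) (d2 t tab).
    by split; [exact: (h1 t tab).1|exact: h2|exact: h3].
- split.
    by move=> s t; rewrite itvE => se tab; have [] := dX s t se tab.
  apply/subspace_continuousP => -[s t] [/= sI tab].
  have se : `|s| < e by rewrite -itvE.
  apply/cvgrPdist_le => eps eps0; rewrite /from_subspace /= X1//.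
  have [d d0 hd] := hc s t se tab eps eps0.
  apply/nbhs_ballP; exists d => //= -[s' t'] [/= bs bt] [/= s'I t'ab].
  have s'e : `|s'| < e by rewrite -itvE.
  rewrite X1// distrC; apply: hd => //; rewrite distrC.
    by move: bs; rewrite -ball_normE.
  by move: bt; rewrite -ball_normE.
- move=> s s'; rewrite !itvE => se s'e ss'; apply: contrapT => nex.
  have eqX t : t \in `[a, b] -> Y s t - Y s' t = 0.
    move=> tab; apply/eqP; rewrite subr_eq0; apply/negPn/negP => neq; apply: nex.
    by exists t => //; rewrite /X (inj_eq (addrI _)).
  have [_ Yps h] := hY s se; have [_ Yps' h'] := hY s' s'e.
  have [h1 _ _] := h a aab; have [h1' _ _] := h' a aab.
  have := is_derive_local_cst _ _ _ a b ab (is_deriveB h1 h1') eqX.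
  rewrite Yps Yps' -scalerBl => /eqP; rewrite scaler_eq0 subr_eq0 (negbTE ss').
  by rewrite (negbTE v0).
- split.
  + by move=> t tab; rewrite /X Y0// addr0.
  + by move=> s; rewrite itvE => se; have [Ya _ _] := hY s se; rewrite /X Ya addr0.
  + apply: contrapT => nex.
    have J0 t : t \in `[a, b] -> J t = 0.
      move=> tab; apply/eqP/negPn/negP => neq; apply: nex.
      by exists t => //; rewrite /variation_field X1// ZJ.
    have := is_derive_local_cst _ _ _ a b ab (dJ a aab) J0.
    by move/eqP; rewrite -/v (negbTE v0).
  + by rewrite /variation_field X1// ZJ.
  + by rewrite /variation_field X1// ZJ.
Qed.
End conjugate_points_family.

Lemma derive_within_setT {R : realType} {W : normedModType R} (f : R -> W) (t : R) :
  derive_within setT f t = 'D_1 f t.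
Proof. by rewrite /derive_within diff_quot_within_setT. Qed.

Lemma derivable_within_setT {R : realType} {W : normedModType R} (f : R -> W) (t : R) :
  derivable_within setT f t -> derivable f t 1.
Proof. by rewrite /derivable_within diff_quot_within_setT. Qed.

(** The rows of A are the Jacobi fields vanishing at a with initial velocities
    the standard basis vectors. *)
Lemma jacobi_matrix_solution {R : realType} {n : nat} (H : R -> 'M[R]_n) (a b : R) :
  a <= b -> continuous H ->
  exists A Ap : R -> 'M[R]_n, [/\ A a = 0, Ap a = 1%:M,
    (forall t, t \in `[a, b] -> is_derive t (1:R) A (Ap t)) &
    (forall t, t \in `[a, b] -> is_derive t (1:R) Ap (- (A t *m H t)))].
Proof.
move=> ab cH.
have [B B0 hB] := continuous_bounded_itv H a b (fun t _ => cH t).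
apply: (second_order_ivp (fun t X => - (X *m H t)) a b (n%:R * B) 1%:M ab).
- by rewrite mulr_ge0.
- move=> t tab X Y; rewrite -opprD normrN -mulmxBl.
  apply/mx_norm_leP; first by rewrite !mulr_ge0.
  move=> i j; apply: le_trans (_ : `|row i (X - Y) *m H t| <= _).
    by rewrite -row_mul; have := mx_entry_le (row i ((X - Y) *m H t)) 0 j; rewrite mxE.
  apply: le_trans (mulmx_norm_le _ _) _; rewrite ler_pM ?mulr_ge0//.
    by rewrite ler_wpM2l// hB.
  by apply/mx_norm_leP => // k l; rewrite mxE; exact: mx_entry_le.
- move=> X cX t; apply: cvgN; apply: cvg_mulmx; first exact: cX.
  apply: (@continuous_comp _ _ _ (clamp a b) H); first exact: clamp_continuous.
  exact: cH.
Qed.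

Theorem theorem3 (R : realType) (n : nat) (I : set R) (U : set 'rV[R]_n)
    (V : R * 'rV[R]_n -> R) (D : set R) (x : R -> 'rV[R]_n)
    (t0 : R) (i j : 'I_n)
    (IU_open : open (I `*` U)) (IU_connected : connected (I `*` U))
    (V_C2 : C2_on (I `*` U) V)
    (x_maximal : maximal_solution I U V D x)
    (x_nonconstant : ~ exists c, forall t, D t -> x t = c)
    (t0_in_D : D t0)
    (velocity_zero : derive_within D x t0 0 i = 0)
    (hess_neq0 : hess_x V (t0, x t0) i j != 0)
    (laplacian_ge0 : forall t, D t -> 0 <= laplacian_x V (t, x t))
    (x_complete : D = setT) :
  exists t1 t2 : R, t1 < t2 /\
    exists (e : R) (X : R -> R -> 'rV[R]_n),
      accumulating_family I U V x t1 t2 e X.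
Proof.
subst D; have [[_ _ xIU eqx] _] := x_maximal.
have xA t : (I `*` U) (t, x t) by exact: xIU.
pose x1 := 'D_1 x.
have x1E : derive_within setT x = x1 by apply/funext => t; exact: derive_within_setT.
have dx t : is_derive t (1:R) x (x1 t).
  by have [/derivable_within_setT h _ _] := eqx t Logic.I; split.
have dx1 t : is_derive t (1:R) x1 (- grad_x V (t, x t)).
  have [_ h2 h3] := eqx t Logic.I; rewrite x1E in h2 h3.
  by split; [exact: derivable_within_setT|rewrite -h3 derive_within_setT].
pose H t := hess_mx V (t, x t).
have cH : continuous H.
  move=> t; apply: (@continuous_comp _ _ _ (fun s => (s, x s)) (hess_mx V)).
    by apply: continuous_pair; [exact: cvg_id|exact: is_derive_continuous (dx t)].
  exact: hess_mx_continuous V_C2 _ (xA t).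
have symH t : (H t)^T = H t by exact: hess_mx_sym IU_open V_C2 _ (xA t).
have trH t : 0 <= \tr (H t).
  have := laplacian_ge0 t Logic.I; rewrite /laplacian_x /mxtrace.
  by under [X in _ -> _ <= X]eq_bigr do rewrite mxE.
have H0 : H t0 != 0.
  apply: contraNneq hess_neq0 => /matrixP /(_ i j).
  by rewrite !mxE => ->.
have [a [b [ab conj]]] := conjugate_points_exist H t0 cH symH trH H0.
have [A [Ap [Aa Apa dA dAp]]] := jacobi_matrix_solution H a b (ltW ab) cH.
have [t2 [at2 t2b sing]] := conj A Ap Aa Apa dA dAp.
have [v v0 vA] : exists2 v : 'rV[R]_n, v != 0 & v *m A t2 = 0.
  by apply/det0P; move: sing; rewrite unitmxE unitfE negbK.
exists a, t2; split=> //.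
have sub t : t \in `[a, t2] -> t \in `[a, b].
  by rewrite !in_itv/= => /andP[-> tt2] /=; exact: le_trans t2b.
have dv t : is_derive t (1:R) (fun=> v) (0 : 'rV[R]_n) := is_derive_cst v t (1:R).
have dJ t : t \in `[a, t2] -> is_derive t (1:R) (fun s => v *m A s) (v *m Ap t).
  move=> /sub tab.
  by apply: (is_derive_eq (is_derive_mulmx _ _ _ _ _ (dv t) (dA t tab))); rewrite mul0mx add0r.
have dJp t : t \in `[a, t2] ->
    is_derive t (1:R) (fun s => v *m Ap s) (- ((v *m A t) *m H t)).
  move=> /sub tab.
  apply: (is_derive_eq (is_derive_mulmx _ _ _ _ _ (dv t) (dAp t tab))).
  by rewrite mul0mx add0r mulmxN mulmxA.
have Ja : v *m A a = 0 by rewrite Aa mulmx0.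
have Jpa : v *m Ap a != 0 by rewrite Apa mulmx1.
exact: (conjugate_points_family I U V IU_open V_C2 x x1 dx dx1 xA a t2 _ _ at2 dJ dJp
  Ja vA Jpa).
Qed.
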